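(* Let $n \geq 2$, $u \geq 1$, $r > 0$ and $1 < s \leq n$. Assume that the Kakeya maximal function $M_{\delta}$ satisfies, for arbitrarily small $\epsilon > 0$, the estimate $$\|M_{\delta}f\|_{L^{r}(S^{n-1})} \leq C(\epsilon)\, \delta^{-(n-s)/s - \epsilon}\, \|f\|_{L^{s}(\mathbb{R}^{n})}$$ for all $f \in L^{s}(\mathbb{R}^{n})$ and all $\delta > 0$, where the constant $C(\epsilon)$ is independent of $\delta$ and $f$. Let $K \subset \mathbb{R}^{n}$ be a Kakeya set, let $(X,d)$ be an arbitrary metric space, and let $g \colon K \to (X,d)$ be a quasisymmetric homeomorphism onto $X$ with the property that $$\mathcal{H}^{n-1}\left(\{e \in S^{n-1} : \text{there is } x \in \mathbb{R}^{n} \text{ with } L_{e}(x) \subset K \text{ and } \mathcal{H}^{u}(g(L_{e}(x))) > 0\}\right) > 0.$$ Then $$\dim_{\mathrm{H}} g(K) \geq su.$$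
   Context: For $e \in S^{n-1}$ and $x \in \mathbb{R}^{n}$, write $L_{e}(x) = \{x + te : 0 \leq t \leq 1\}$, and for $\delta > 0$ let $T_{e}^{\delta}(x)$ be the closed $\delta$-neighbourhood of $L_{e}(x)$ in $\mathbb{R}^{n}$. For a locally integrable function $f$ on $\mathbb{R}^{n}$, the Kakeya maximal function $M_{\delta}f \colon S^{n-1} \to [0,\infty]$ is $$(M_{\delta}f)(e) := \sup_{x \in \mathbb{R}^{n}} \frac{1}{|T_{e}^{\delta}(x)|} \int_{T_{e}^{\delta}(x)} |f(y)| \, dy,$$ where $|\cdot|$ is Lebesgue measure. The sphere $S^{n-1}$ is equipped with $\mathcal{H}^{n-1}$, and $\|h\|_{L^{r}(S^{n-1})} = (\int_{S^{n-1}} |h|^{r}\, d\mathcal{H}^{n-1})^{1/r}$, also when $0 < r < 1$. Here $\mathcal{H}^{u}$ denotes $u$-dimensional Hausdorff (outer) measure and $\dim_{\mathrm{H}}$ Hausdorff dimension. ''For arbitrarily small $\epsilon > 0$'' means that for every $\epsilon_{0} > 0$ there is $\epsilon \in (0,\epsilon_{0})$ for which the estimate holds with some finite constant $C(\epsilon)$. A set $K \subset \mathbb{R}^{n}$, $n \geq 2$, is called a Kakeya set if there exists a set $S \subset S^{n-1}$ of positive $\mathcal{H}^{n-1}$-measure such that for every $e \in S$ the set $K$ contains a unit line segment of the form $L_{e}(x)$ for some $x \in \mathbb{R}^{n}$. A homeomorphism $g$ from a metric space $(X_1,d_1)$ onto a metric space $(X_2,d_2)$ is quasisymmetric if there exists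 an increasing homeomorphism $\eta \colon [0,\infty) \to [0,\infty)$ such that $$\frac{d_2(g(x),g(y))}{d_2(g(x),g(z))} \leq \eta\left(\frac{d_1(x,y)}{d_1(x,z)}\right)$$ for all $x,y,z \in X_1$ with $x \neq z$. The set $K$ carries the Euclidean metric. *)

(* Defs.v *)
From HB Require Import structures.
From mathcomp Require Import all_boot all_order all_algebra.
From mathcomp Require Import all_classical all_reals all_analysis.
From mathcomp Require Import ring lra.

Set Implicit Arguments.
Unset Strict Implicit.
Unset Printing Implicit Defensive.

Import Order.TTheory GRing.Theory Num.Theory.
Import numFieldNormedType.Exports.

Local Open Scope classical_set_scope.
Local Open Scope ring_scope.

(* Only the nonempty members of a cover are required to lie in C and
   contribute to the sum, so that finite covers are included and the empty
   set has measure 0 whatever w set0 is. *)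
Section cover_measure.
Context {R : realType} {T : Type}.
Variables (C : set (set T)) (w : set T -> \bar R).
Local Open Scope ereal_scope.

Definition countable_cover (A : set T) : set (set T)^nat :=
  [set F | (forall k, F k !=set0 -> C (F k)) /\ A `<=` \bigcup_k F k].

Definition cover_measure (A : set T) : \bar R :=
  ereal_inf [set \sum_(k <oo | F k != set0) w (F k) | F in countable_cover A].

Hypothesis w_ge0 : forall U, C U -> 0 <= w U.

Let v (U : set T) : \bar R := if U == set0 then 0 else w U.

Let vE (F : (set T)^nat) :
  \sum_(k <oo | F k != set0) w (F k) = \sum_(k <oo) v (F k).
Proof.
rewrite eseries_mkcond; apply: eq_eseriesr => k _.
by rewrite /v; case: eqVneq.
Qed.

Let v_ge0 A F k : countable_cover A F -> 0 <= v (F k).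
Proof.
move=> [CF _]; rewrite /v; case: eqVneq => // /set0P Fk.
by apply: w_ge0; exact: CF.
Qed.

Lemma cover_measure_ge0 A : 0 <= cover_measure A.
Proof.
apply: le_ereal_inf_tmp => _ [F FA <-]; rewrite vE.
by apply: nneseries_ge0 => k _ _; exact: v_ge0 FA.
Qed.

Lemma cover_measure0 : cover_measure set0 = 0.
Proof.
apply/eqP; rewrite eq_le cover_measure_ge0 andbT.
apply: ereal_inf_lbound; exists (fun=> set0); first by split => // k [].
by rewrite vE eseries0// => k _ _; rewrite /v eqxx.
Qed.

Lemma le_cover_measure : {homo cover_measure : A B / A `<=` B >-> A <= B}.
Proof.
move=> A B AB; apply/ereal_inf_le_tmp => _ [F [CF BF] <-].
by exists F => //; split => //; exact: subset_trans AB BF.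
Qed.

Lemma cover_measure_sigma_subadditive : sigma_subadditive cover_measure.
Proof.
move=> A; have [[i ioo]|] := pselect (exists i, cover_measure (A i) = +oo).
  rewrite (eseries_pinfty _ _ ioo) ?leey// => n _.
  by rewrite -ltNye (lt_le_trans _ (cover_measure_ge0 _)).
rewrite -forallNE => Aoo.
apply/lee_addgt0Pr => _/posnumP[e].
rewrite (le_trans _ (epsilon_trick _ _ _))//; last first.
  by move=> n; exact: cover_measure_ge0.
pose P n (B : (set T)^nat) := countable_cover (A n) B /\
  \sum_(k <oo) v (B k) <= cover_measure (A n) + (e%:num / (2 ^ n.+1)%:R)%:E.
have [G PG] : {G : ((set T)^nat)^nat & forall n, P n (G n)}.
  apply: (@choice _ _ P) => n; rewrite /P.
  have en1 : (0 < e%:num / (2 ^ n.+1)%:R)%R by [].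
  have fin : cover_measure (A n) \is a fin_num.
    by rewrite ge0_fin_numE ?cover_measure_ge0// ltey; apply/eqP.
  have [x [B cB <-] xS] := lb_ereal_inf_adherent en1 fin.
  by exists B; split => //; rewrite -vE; exact/ltW.
have muG_ge0 x : 0 <= (v \o uncurry G) x.
  by case: x => i j /=; exact: v_ge0 (PG i).1.
apply: (@le_trans _ _ (\esum_(i in setT) (v \o uncurry G) i)).
  apply: ereal_inf_lbound => /=.
  have /card_esym/ppcard_eqP[f] := card_nat2.
  exists (uncurry G \o f).
    split => [i|].
      by rewrite /=; case: (f i) => a b; exact: (PG a).1.1.
    apply: (@subset_trans _  (\bigcup_n \bigcup_k G n k)) => [t [i _]|].
      by move=> /((PG i).1.2) -[j _ ?]; exists i => //; exists j.
    move=> t [i _ [j _ Bijt]]; exists (f^-1%FUN (i, j)) => //=.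
    by rewrite invK ?inE.
  rewrite vE -(esum_pred_image (v \o uncurry G) _ xpredT) ?[fun=> _]set_true//.
  by rewrite image_eq.
rewrite (_ : esum _ _ = \sum_(i <oo) \sum_(j <oo) v (G i j)); last first.
  pose J : nat -> set (nat * nat) := fun i => [set (i, j) | j in setT].
  rewrite (_ : setT = \bigcup_k J k); last first.
    by rewrite predeqE => -[a b]; split => // _; exists a => //; exists b.
  rewrite esum_bigcupT /=; last 2 first.
    - apply/trivIsetP => i j _ _ ij.
      rewrite predeqE => -[n m] /=; split => //= -[] [_] _ [<-{n} _].
      by move=> [m' _] [] /esym/eqP; rewrite (negbTE ij).
    - by move=> x; exact: muG_ge0.
  rewrite -(image_id [set: nat]) -fun_true esum_pred_image//; last first.
    by move=> n _; apply: esum_ge0 => x _; exact: muG_ge0.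
  apply: eq_eseriesr => /= j _.
  rewrite -(esum_pred_image (v \o uncurry G) (pair j) predT)//=; last 2 first.
    by move=> i _; exact: (muG_ge0 (j, i)).
    by move=> ? ? _ _; exact: (@can_inj _ _ _ snd).
  by congr esum; rewrite predeqE => -[a b]; split; move=> [i _ <-]; exists i.
apply: lee_lim.
- apply: is_cvg_nneseries => n *.
  by apply: nneseries_ge0 => m *; exact: (muG_ge0 (n, m)).
- by apply: is_cvg_nneseries => n *; apply: adde_ge0 => //; exact: cover_measure_ge0.
- by near=> n; apply: lee_sum => i _; exact: (PG i).2.
Unshelve. all: by end_near. Qed.

End cover_measure.

Definition caratheodory_measure {R : realType} {T : pointedType}
    (mu : {outer_measure set T -> \bar R}) :
    {measure set (caratheodory_type mu) -> \bar R} :=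
  (mu : set (caratheodory_type mu) -> \bar R).

Section hausdorff.
Context {R : realType} {X : metricType R}.
Implicit Types (U A : set X) (u : R).
Local Open Scope ereal_scope.

Definition diameter U : \bar R :=
  ereal_sup [set (mdist z.1 z.2)%:E | z in U `*` U].

Definition hausdorff_premeasure u (delta : R) : set X -> \bar R :=
  cover_measure [set U | diameter U <= delta%:E] (fun U => diameter U `^ u).

(* Not multiplied by any dimensional constant. *)
Definition hausdorff_measure u A : \bar R :=
  ereal_sup [set hausdorff_premeasure u delta A | delta in [set d | (0 < d)%R]].

Definition hausdorff_dim A : \bar R :=
  ereal_inf [set u%:E | u in [set u | (0 <= u)%R /\ hausdorff_measure u A = 0]].

Let pre_ge0 u d A : 0 <= hausdorff_premeasure u d A.
Proof. by apply: cover_measure_ge0 => U _; exact: poweR_ge0. Qed.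

Let hausdorff_measure_ge0 u A : 0 <= hausdorff_measure u A.
Proof.
apply: (le_trans (pre_ge0 u 1 A)); apply: ereal_sup_ubound.
by exists 1%R => //=.
Qed.

Let hausdorff_measure0 u : hausdorff_measure u set0 = 0.
Proof.
apply/eqP; rewrite eq_le hausdorff_measure_ge0 andbT.
apply: ge_ereal_sup => _ [d _ <-]; rewrite /hausdorff_premeasure.
by rewrite cover_measure0// => U _; exact: poweR_ge0.
Qed.

Let le_hausdorff_measure u :
  {homo hausdorff_measure u : A B / A `<=` B >-> A <= B}.
Proof.
move=> A B AB; apply: ge_ereal_sup => _ [d d0 <-].
apply: (@le_trans _ _ (hausdorff_premeasure u d B)).
  exact: le_cover_measure.
by apply: ereal_sup_ubound; exists d.
Qed.

Let hausdorff_measure_sigma_subadditive u :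
  sigma_subadditive (hausdorff_measure u).
Proof.
move=> F; apply: ge_ereal_sup => _ [d d0 <-].
apply: (@le_trans _ _ (\sum_(i <oo) hausdorff_premeasure u d (F i))).
  by apply: cover_measure_sigma_subadditive => U _; exact: poweR_ge0.
apply: lee_nneseries => [i _ _|i _]; first exact: pre_ge0.
by apply: ereal_sup_ubound; exists d.
Qed.

HB.instance Definition _ u := isOuterMeasure.Build R X (hausdorff_measure u)
  (hausdorff_measure0 u) (hausdorff_measure_ge0 u) (@le_hausdorff_measure u)
  (@hausdorff_measure_sigma_subadditive u).

End hausdorff.

(* 'rV[R]_n itself carries the sup distance in the library; this copy carries
   the Euclidean one. *)
Definition euclidean (R : realType) (n : nat) : Type := 'rV[R]_n.

Section euclidean.
Context {R : realType} {n : nat}.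
Local Notation E := (euclidean R n).

HB.instance Definition _ := Pointed.on E.
HB.instance Definition _ := GRing.Lmodule.on E.

Definition ecoord (i : 'I_n) (x : E) : R := (x : 'rV[R]_n) ord0 i.

Definition enorm (x : E) : R := Num.sqrt (\sum_(i < n) ecoord i x ^+ 2).

Lemma ecoordD i x y : ecoord i (x + y) = ecoord i x + ecoord i y.
Proof. by rewrite /ecoord mxE. Qed.

Lemma ecoordN i x : ecoord i (- x) = - ecoord i x.
Proof. by rewrite /ecoord mxE. Qed.

Lemma ecoordZ i t x : ecoord i (t *: x) = t * ecoord i x.
Proof. by rewrite /ecoord mxE. Qed.

Lemma sumsqr_ge0 (x : E) : 0 <= \sum_(i < n) ecoord i x ^+ 2.
Proof. by apply: sumr_ge0 => i _; exact: sqr_ge0. Qed.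

Lemma enorm_eq0 (x : E) : enorm x = 0 -> x = 0.
Proof.
move=> /eqP; rewrite /enorm sqrtr_eq0 => s0.
have /eqP : \sum_(i < n) ecoord i x ^+ 2 == 0 by rewrite eq_le s0 sumsqr_ge0.
move=> /psumr_eq0P H; apply/rowP => i; rewrite [RHS]mxE.
have /eqP := H (fun i _ => sqr_ge0 _) i isT.
by rewrite sqrf_eq0 => /eqP.
Qed.

Lemma enormN (x : E) : enorm (- x) = enorm x.
Proof.
by congr Num.sqrt; apply: eq_bigr => i _; rewrite ecoordN sqrrN.
Qed.

Lemma enorm_dot (x y : E) :
  \sum_(i < n) ecoord i x * ecoord i y <= enorm x * enorm y.
Proof.
set a := enorm x; set b := enorm y.
have a2 : \sum_(i < n) ecoord i x ^+ 2 = a ^+ 2 by rewrite sqr_sqrtr// sumsqr_ge0.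
have b2 : \sum_(i < n) ecoord i y ^+ 2 = b ^+ 2 by rewrite sqr_sqrtr// sumsqr_ge0.
have a0 : 0 <= a by exact: sqrtr_ge0.
have b0 : 0 <= b by exact: sqrtr_ge0.
have [/enorm_eq0 x0|aN0] := eqVneq a 0.
  rewrite big1 ?mulr_ge0// => i _.
  by rewrite x0 /ecoord mxE mul0r.
have [/enorm_eq0 y0|bN0] := eqVneq b 0.
  rewrite big1 ?mulr_ge0// => i _.
  by rewrite y0 /ecoord mxE mulr0.
have ab0 : 0 < a * b by rewrite mulr_gt0// lt0r ?aN0 ?bN0.
set S := \sum_(i < n) _.
have : 0 <= \sum_(i < n) (b * ecoord i x - a * ecoord i y) ^+ 2.
  by apply: sumr_ge0 => i _; exact: sqr_ge0.
have -> : \sum_(i < n) (b * ecoord i x - a * ecoord i y) ^+ 2 =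
    (2 * (a * b)) * (a * b - S).
  transitivity (\sum_(i < n) (b ^+ 2 * ecoord i x ^+ 2
      + a ^+ 2 * ecoord i y ^+ 2 - (2 * (a * b)) * (ecoord i x * ecoord i y))).
    by apply: eq_bigr => i _; ring.
  rewrite sumrB big_split/= -!mulr_sumr a2 b2 -/S; ring.
by rewrite pmulr_rge0 ?subr_ge0// mulr_gt0.
Qed.

Lemma enormD (x y : E) : enorm (x + y) <= enorm x + enorm y.
Proof.
rewrite -(@ler_pXn2r _ 2)// ?nnegrE ?addr_ge0 ?sqrtr_ge0//.
rewrite sqrrD !sqr_sqrtr ?sumsqr_ge0//.
under eq_bigr => i _ do rewrite ecoordD sqrrD.
rewrite !big_split/= lerD2r lerD2l [leRHS]mulr2n lerD//; exact: enorm_dot.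
Qed.

Definition eucl_dist (x y : E) : R := enorm (x - y).

Let eucl_distxx x : eucl_dist x x = 0.
Proof.
rewrite /eucl_dist subrr /enorm big1 ?sqrtr0// => i _.
by rewrite /ecoord mxE expr0n.
Qed.

Let eucl_dist_positivity x y : eucl_dist x y = 0 -> x = y.
Proof. by move=> /enorm_eq0/eqP; rewrite subr_eq0 => /eqP. Qed.

Let eucl_dist_sym x y : eucl_dist x y = eucl_dist y x.
Proof. by rewrite /eucl_dist -enormN opprB. Qed.

Let eucl_dist_triangle y x z : eucl_dist x z <= eucl_dist x y + eucl_dist y z.
Proof.
rewrite /eucl_dist (_ : x - z = (x - y) + (y - z)); first exact: enormD.
by rewrite addrA subrK.
Qed.

HB.instance Definition _ := @isMetric.Build R E eucl_dist
  eucl_distxx eucl_dist_positivity eucl_dist_sym eucl_dist_triangle.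

End euclidean.

Section lebesgue.
Context {R : realType} (n : nat).
Local Notation E := (euclidean R n).

Definition box (a b : E) : set E :=
  [set x | forall i, ecoord i x \in `[ecoord i a, ecoord i b[].

(* For a nonempty box, the product of the side lengths. *)
Definition box_volume (B : set E) : \bar R :=
  (\prod_(i < n) lebesgue_measure (ecoord i @` B))%E.

Definition lebesgue_outer : set E -> \bar R :=
  cover_measure [set box ab.1 ab.2 | ab in [set: E * E]] box_volume.

Lemma box_volume_ge0 B : (0 <= box_volume B)%E.
Proof. by apply: prode_ge0 => i _; exact: measure_ge0. Qed.

HB.instance Definition _ := isOuterMeasure.Build R E lebesgue_outer
  (cover_measure0 (fun B _ => box_volume_ge0 B))
  (cover_measure_ge0 (fun B _ => box_volume_ge0 B))
  (@le_cover_measure _ _ _ _)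
  (cover_measure_sigma_subadditive (fun B _ => box_volume_ge0 B)).

Definition lebesgue := caratheodory_measure lebesgue_outer.

End lebesgue.
Arguments lebesgue {R} n.

Section kakeya.
Context {R : realType} {n : nat}.
Local Notation E := (euclidean R n).
Implicit Types (e x y : E) (K : set E).

Definition unit_sphere : set E := [set e | enorm e = 1].

(* A measure on the whole space, to be integrated over unit_sphere. *)
Definition sphere_measure := @caratheodory_measure R E
  (@hausdorff_measure R E (n%:R - 1)).

Definition segment e x : set E := [set x + t *: e | t in `[0, 1]].

Definition tube delta e x : set E :=
  [set y | inf [set mdist y z | z in segment e x] <= delta].

Definition kakeya_maximal delta (f : E -> R) e : \bar R :=
  ereal_sup [set ((lebesgue n (tube delta e x))^-1 *
    \int[lebesgue n]_(y in tube delta e x) `|f y|%:E)%E | x in [set: E]].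

Definition kakeya_set K : Prop :=
  exists S : set E, [/\ S `<=` unit_sphere,
    (0 < hausdorff_measure (n%:R - 1) S)%E &
    forall e, S e -> exists x, segment e x `<=` K].

End kakeya.

(* Subsets A, B of ambient spaces carry the induced topologies and metrics;
   the values of f outside A are irrelevant. *)
Definition homeomorphism_on {X Y : topologicalType} (A : set X) (B : set Y)
    (f : X -> Y) : Prop :=
  exists h : Y -> X,
    [/\ set_fun A B f, set_fun B A h,
        {in A, cancel f h}, {in B, cancel h f} &
        {within A, continuous f} /\ {within B, continuous h}].

Definition quasisymmetric_on {R : realType} {X Y : metricType R}
    (A : set X) (B : set Y) (g : X -> Y) : Prop :=
  homeomorphism_on A B g /\
  exists eta : R -> R,
    [/\ @homeomorphism_on R R `[0, +oo[ `[0, +oo[ eta,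
        {in `[0, +oo[ &, {homo eta : a b / a < b}} &
        forall x y z, A x -> A y -> A z -> x != z ->
          mdist (g x) (g y) / mdist (g x) (g z) <=
          eta (mdist x y / mdist x z)].

(* Main.v *)
From HB Require Import structures.
Require Import Defs.
From mathcomp Require Import all_boot all_order all_algebra.
From mathcomp Require Import all_classical all_reals all_analysis.
From mathcomp Require Import measurable_realfun ring lra.

Set Implicit Arguments.
Unset Strict Implicit.
Unset Printing Implicit Defensive.

Import Order.TTheory GRing.Theory Num.Theory.
Import numFieldNormedType.Exports.

Local Open Scope classical_set_scope.
Local Open Scope ring_scope.

(* Suppose H^t (g K) = 0 with t < s u. On the union of the unit segments of K
   lying in a fixed ball, g shrinks diameters geometrically along the scales
   delta = p^-k, by quasisymmetry. Cover g K by sets F_i of small diameter d_i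
   with small sum of the d_i^t, and sort the preimages by the scale of their
   diameter. A segment L with H^u (g L) > 0 splits at each scale into pieces of
   length delta; a piece meeting the preimage of F_i at that scale has image of
   diameter at most a constant times d_i, so by subadditivity and two
   pigeonholes with geometric weights q^k some scale k carries a set of
   directions of measure >~ q^k for which the pieces of size delta satisfy
   sum d_i^u >~ q^k. Apply the maximal inequality at that scale to
   f = delta^-1 (sum_i d_i^(s u) 1_(Q_i))^(1/s), with Q_i a cube of side
   ~ delta around the preimage of F_i: M_delta f >~ q^k on these directions,
   whereas the right-hand side is at most
   delta^-eps (sum_i d_i^(s u))^(1/s) <~ delta^-eps 2^(-k (u - t/s)) eta^(1/s)
   with eta the bound on the sum of the d_i^t. For q close to 1 and eps small
   the powers of k cancel, and eta -> 0 is a contradiction. *)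

(** * Monotonicity of integrals without measurability, and a weighted pigeonhole *)

Section nonmeasurable_integral.
Local Open Scope ereal_scope.
Context d (T : measurableType d) (R : realType).
Variable mu : {measure set T -> \bar R}.

(** The integral of a nonnegative function is a supremum over the simple functions below it, so
    monotonicity needs no measurability. Integrands such as [kakeya_maximal] are never shown to be
    measurable. *)
Lemma ge0_le_integral_restrict (D E : set T) (f g : T -> \bar R) :
  (forall x, D x -> 0 <= f x) -> (forall x, E x -> 0 <= g x) ->
  (forall x, (f \_ D) x <= (g \_ E) x) ->
  \int[mu]_(x in D) f x <= \int[mu]_(x in E) g x.
Proof.
move=> f0 g0 fg; rewrite !ge0_integralE//.
apply: ereal_sup_le => _ [h hf <-]; exists h => // x.
exact: le_trans (hf x) (fg x).
Qed.

End nonmeasurable_integral.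

(** Otherwise the partial sums are at most [h (1 - q^n) <= h]. Applied once to the scales along a
    segment and once to the scales selected by the directions. *)
Lemma geometric_pigeonhole (R : realType) (a : (\bar R)^nat) (h q : R) :
  0 <= h -> 0 < q < 1 -> (forall k, (0 <= a k)%E) ->
  (h%:E < \sum_(k <oo) a k)%E -> exists k, ((h * (1 - q) * q ^+ k)%:E < a k)%E.
Proof.
move=> h0 /andP[q0 q1] a0 ha; apply: contrapT => /forallNP H.
move: ha; apply/negP; rewrite -leNgt.
apply: lime_le; first exact: is_cvg_nneseries.
apply: nearW => n; apply: (@le_trans _ _ (h * (1 - q ^+ n))%:E); last first.
  by rewrite lee_fin ler_piMr// gerBl exprn_ge0// ltW.
elim: n => [|n ih]; first by rewrite big_geq// expr0 subrr mulr0.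
rewrite big_nat_recr//=.
have -> : h * (1 - q ^+ n.+1) = h * (1 - q ^+ n) + h * (1 - q) * q ^+ n.
  by rewrite exprS; ring.
by rewrite EFinD leeD// leNgt; apply/negP/H.
Qed.

(** * Hausdorff measures are metric outer measures *)

Section metric_outer_measure.
Context {R : realType} {X : metricType R}.
Local Open Scope ereal_scope.

Definition metric_outer (mu : set X -> \bar R) := forall (A B : set X) (e : R),
  (0 < e)%R -> (forall x y, A x -> B y -> (e <= mdist x y)%R) ->
  mu A + mu B <= mu (A `|` B).

(* The shells c - 1/(k+1) < phi <= c - 1/(k+2) are separated from their second
   neighbours, which makes their measures summable. *)
Lemma metric_outer_caratheodory (mu : {outer_measure set X -> \bar R})
    (phi : X -> R) (c : R) :
  metric_outer mu -> (forall x y, (phi x - phi y <= mdist x y)%R) ->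
  mu.-caratheodory [set x | (phi x < c)%R].
Proof.
move=> mo lip; apply: le_caratheodory_measurable => Z.
have [->|Zoo] := eqVneq (mu Z) +oo; first by rewrite leey.
pose t (k : nat) : R := (k.+1%:R^-1)%R.
have tS k : (t k.+1 < t k)%R by rewrite ltf_pV2 ?posrE// ltr_nat.
have t0 k : (0 < t k)%R by rewrite invr_gt0.
pose Zk k := Z `&` [set x | (phi x <= c - t k)%R].
pose Rk k := Z `&` [set x | (c - t k < phi x <= c - t k.+1)%R].
have ZkZ k : mu (Zk k) <= mu Z by apply: le_outer_measure => x [].
have RS N : \sum_(0 <= k < N.+1) mu (Rk k) <= mu (Zk N.+1) + mu (Zk N).
  elim: N => [|N ih].
    rewrite big_nat1; apply: (@le_trans _ _ (mu (Zk 1%N))).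
      by apply: le_outer_measure => x [Zx /= /andP[_]].
    by rewrite leeDl// outer_measure_ge0.
  rewrite big_nat_recr//=; apply: (le_trans (leeD2r _ ih)).
  rewrite -addeA addeC leeD2r//.
  apply: le_trans (mo _ _ (t N - t N.+1)%R _ _) _.
  - by rewrite subr_gt0.
  - move=> x y [_ /= x1] [_ /= /andP[y1 _]]; rewrite metric_sym.
    apply: le_trans (lip y x); lra.
  - apply: le_outer_measure => x [[Zx /= h]|[Zx /= /andP[_ h]]]; split => //=.
    by apply: (le_trans h); rewrite lerB// ltW// (lt_trans (tS _)).
have R_ge0 k : true -> 0 <= mu (Rk k) by rewrite outer_measure_ge0.
have Rfin : \sum_(k <oo) mu (Rk k) < +oo.
  apply: (@le_lt_trans _ _ (mu Z + mu Z)); last first.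
    by rewrite lte_add_pinfty// ltey.
  apply: lime_le; first by apply: is_cvg_nneseries => *; exact: R_ge0.
  apply: nearW => -[|n]; first by rewrite big_geq// adde_ge0// outer_measure_ge0.
  by apply: (le_trans (RS n)); rewrite leeD.
have := nneseries_tail_cvg Rfin R_ge0.
move/fine_cvgP => [tfin /cvgr0Pnorm_lt tail].
apply/lee_addgt0Pr => e e0.
have [k _ /(_ k (leqnn k))] := filterI tfin (tail e e0).
move=> [/= kfin]; rewrite ger0_norm; last first.
  by apply: fine_ge0; apply: nneseries_ge0 => *; exact: R_ge0.
rewrite -lte_fin fineK// => ke.
have WZ : Z `&` [set x | (phi x < c)%R] `<=` Zk k `|` \bigcup_(j in ~` `I_k) Rk j.
  move=> x [Zx /= xc].
  have [xk|xk] := leP (phi x) (c - t k)%R; first by left.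
  right.
  have : exists j, (phi x <= c - t j)%R.
    exists (Num.truncn (c - phi x)^-1%R).
    rewrite lerBrDl -lerBrDr /t invf_ple ?posrE ?subr_gt0//.
    exact/ltW/truncnS_gt.
  case/ex_minnP => j xj jmin; case: j => [|j] in xj jmin *.
    move: xk; rewrite ltNge => /negP; case; apply: (le_trans xj).
    by rewrite lerB// /t lef_pV2 ?posrE// ler_nat.
  have jx : (c - t j < phi x)%R.
    by rewrite ltNge; apply/negP => /jmin; rewrite ltnn.
  exists j; last by split => //=; rewrite jx.
  move=> /= jk; move: xk; rewrite ltNge => /negP; apply; apply: (le_trans xj).
  by rewrite lerB// /t lef_pV2 ?posrE// ler_nat.
have W1 : mu (Z `&` [set x | (phi x < c)%R]) <= mu (Zk k) + e%:E.
  apply: le_trans (le_outer_measure mu _ _ WZ) _.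
  apply: le_trans (outer_measureU2 _ _ _) _; rewrite leeD2l//.
  apply: le_trans (outer_measure_sigma_subadditive_tail _ _ _) _.
  exact: ltW.
apply: (le_trans (leeD2r _ W1)); rewrite addeAC leeD2r//.
apply: le_trans (mo _ _ (t k) _ _) _ => //.
- move=> x y [_ /= x1] [_ /= /negP]; rewrite -leNgt => y1.
  by rewrite metric_sym; apply: le_trans (lip y x); lra.
- by apply: le_outer_measure => x [[]|[]].
Qed.

End metric_outer_measure.

Section cover_measure_theory.
Context {R : realType} {T : Type}.
Variables (C : set (set T)) (w : set T -> \bar R).
Local Open Scope ereal_scope.

Lemma cover_measure_le U : C U -> 0 <= w U -> cover_measure C w U <= w U.
Proof.
move=> CU wU; pose F (k : nat) := if k == 0%N then U else set0.
apply: (@le_trans _ _ (\sum_(k <oo | F k != set0) w (F k))).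
  apply: ereal_inf_lbound; exists F => //; split => [[|k]|x Ux] //=.
    by move=> [].
  by exists 0%N.
rewrite eseries_mkcond nneseries_recl//=; last first.
  by move=> [|k] _ /=; [case: ifP|rewrite eqxx].
rewrite eseries0 ?adde0; first by case: ifP.
by move=> [|k] _ _ //=; rewrite eqxx.
Qed.

End cover_measure_theory.

(** Apart from [M = +oo] everything is finite, and the two summands can be moved across the
    inequality in turn. *)
Lemma ge_ereal_supD (R : realType) (S T : set (\bar R)) (M : \bar R) :
  S !=set0 -> T !=set0 -> (forall a, S a -> 0 <= a)%E ->
  (forall b, T b -> 0 <= b)%E -> (forall a b, S a -> T b -> a + b <= M)%E ->
  (ereal_sup S + ereal_sup T <= M)%E.
Proof.
move=> [s0 Ss] [t0 Tt] S0 T0 STM.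
have [->|Moo] := eqVneq M +oo%E; first by rewrite leey.
have fM x : (0 <= x)%E -> (x <= M)%E -> x \is a fin_num.
  by move=> x0 xM; rewrite ge0_fin_numE// (le_lt_trans xM)// ltey.
have TM : (ereal_sup T <= M)%E.
  apply: ge_ereal_sup => b Tb; apply: le_trans (STM _ _ Ss Tb).
  by rewrite leeDr// S0.
have Tfin : ereal_sup T \is a fin_num.
  by apply: fM => //; apply: le_trans (T0 _ Tt) _; exact: ereal_sup_ubound.
rewrite -leeBrDr//; apply: ge_ereal_sup => a Sa; rewrite leeBrDr// addeC.
have afin : a \is a fin_num.
  apply: fM; [exact: S0|]; apply: le_trans (STM _ _ Sa Tt).
  by rewrite leeDl// T0.
rewrite -leeBrDr//; apply: ge_ereal_sup => b Tb; rewrite leeBrDr// addeC.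
exact: STM.
Qed.

Section hausdorff_theory.
Context {R : realType} {X : metricType R}.
Local Open Scope ereal_scope.
Implicit Types (A B : set X) (u d e : R).

Lemma hausdorff_premeasure_ge0 u d A : 0 <= hausdorff_premeasure u d A.
Proof. by apply: cover_measure_ge0 => U _; exact: poweR_ge0. Qed.

Lemma hausdorff_premeasure_sigma_subadditive u d :
  sigma_subadditive (@hausdorff_premeasure R X u d).
Proof.
by apply: cover_measure_sigma_subadditive => U _; exact: poweR_ge0.
Qed.

Lemma hausdorff_premeasure0 u d : @hausdorff_premeasure R X u d set0 = 0.
Proof. by apply: cover_measure0 => U _; exact: poweR_ge0. Qed.

Lemma subset_hausdorff_premeasure u d :
  {homo @hausdorff_premeasure R X u d : A B / A `<=` B >-> A <= B}.
Proof. exact: le_cover_measure. Qed.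

HB.instance Definition _ u d := isOuterMeasure.Build R X (hausdorff_premeasure u d)
  (hausdorff_premeasure0 u d) (hausdorff_premeasure_ge0 u d)
  (@subset_hausdorff_premeasure u d)
  (@hausdorff_premeasure_sigma_subadditive u d).

Lemma le_hausdorff_premeasure u d1 d2 A : (d1 <= d2)%R ->
  hausdorff_premeasure u d2 A <= hausdorff_premeasure u d1 A.
Proof.
move=> d12; apply: ereal_inf_le_tmp => _ [F [CF AF] <-]; exists F => //.
split=> // k /CF /= /le_trans; apply.
by rewrite lee_fin.
Qed.

Lemma hausdorff_premeasure_le u d A (r : R) : (0 < u)%R -> (0 <= r <= d)%R ->
  (forall x y, A x -> A y -> (mdist x y <= r)%R) ->
  hausdorff_premeasure u d A <= (r `^ u)%:E.
Proof.
move=> u0 /andP[r0 rd] Ar.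
have dA : diameter A <= r%:E.
  by apply: ge_ereal_sup => _ [[x y] [/= Ax Ay] <-]; rewrite lee_fin; exact: Ar.
apply: le_trans (cover_measure_le _ _) _; rewrite /= ?poweR_ge0//.
  by apply: (le_trans dA); rewrite lee_fin.
rewrite -poweR_EFin.
(* The diameter of the empty set is [-oo], whose power with exponent [u > 0] is 0 by convention. *)
have [->|/set0P[x Ax]] := eqVneq A set0.
  rewrite /diameter (_ : _ @` _ = set0) ?ereal_sup0; last first.
    by apply/seteqP; split => // x [[y z] []].
  by rewrite poweRNyr ?gt_eqF// poweR_ge0.
have dA0 : 0 <= diameter A.
  by apply: ereal_sup_ubound; exists (x, x) => //=; rewrite mdistxx.
by apply: gt0_ler_poweR => //; rewrite ?ltW// in_itv/= leey ?dA0 ?lee_fin ?r0.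
Qed.

(** At a scale [d < e] no member of a cover meets both sets, so a cover of the union splits into
    covers of [A] and of [B] with no member counted twice. *)
Lemma hausdorff_metric_outer u : metric_outer (@hausdorff_measure R X u).
Proof.
move=> A B e e0 AB.
have preD d : (d < e)%R -> hausdorff_premeasure u d A +
    hausdorff_premeasure u d B <= hausdorff_premeasure u d (A `|` B).
  move=> de; apply: le_ereal_inf_tmp => _ [F [CF ABF] <-].
  pose sub (Y : set X) k := if `[< F k `&` Y !=set0 >] then F k else set0.
  have subF (Y : set X) : Y `<=` A `|` B -> hausdorff_premeasure u d Y <=
      \sum_(k <oo | sub Y k != set0) diameter (sub Y k) `^ u.
    move=> YAB; apply: ereal_inf_lbound; exists (sub Y) => //; split.
      by move=> k; rewrite /sub; case: asboolP => [_|_ []//]; exact: CF.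
    move=> x Yx; have [k _ Fkx] := ABF _ (YAB _ Yx); exists k => //.
    by rewrite /sub asboolT//; exists x.
  apply: (le_trans (leeD (subF A (@subsetUl _ A B)) (subF B (@subsetUr _ A B)))).
  rewrite eseries_mkcond [X in _ + X]eseries_mkcond [leRHS]eseries_mkcond.
  have w0 (P : bool) (U : set X) : 0 <= (if P then diameter U `^ u else 0).
    by case: P => //; exact: poweR_ge0.
  rewrite -nneseriesD//; apply: lee_nneseries => [k *|k _].
    by apply: adde_ge0.
  rewrite /sub; case: asboolP => [[x [Fx Ax]]|_]; case: asboolP => [[y [Fy By]]|_].
  - exfalso; have Fk0 : F k !=set0 by exists x.
    have : (mdist x y)%:E <= d%:E.
      by apply: le_trans (CF _ Fk0); apply: ereal_sup_ubound; exists (x, y).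
    by rewrite lee_fin leNgt => /negP; apply; rewrite (lt_le_trans de)// AB.
  - by rewrite eqxx/= adde0.
  - by rewrite eqxx/= add0e.
  - by rewrite eqxx/= add0e.
apply: ge_ereal_supD.
- by exists (hausdorff_premeasure u 1 A), 1%R => //=.
- by exists (hausdorff_premeasure u 1 B), 1%R => //=.
- by move=> _ [d _ <-]; exact: hausdorff_premeasure_ge0.
- by move=> _ [d _ <-]; exact: hausdorff_premeasure_ge0.
move=> _ _ [d1 /= d10 <-] [d2 /= d20 <-].
(* A scale below both given ones and below [e]; refining the scale only increases the
   premeasures. *)
pose d := Num.min (Num.min d1 d2) (e / 2)%R.
apply: (@le_trans _ _ (hausdorff_premeasure u d (A `|` B))); last first.
  apply: ereal_sup_ubound; exists d => //=.
  by rewrite !lt_min d10 d20 divr_gt0.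
apply: le_trans (preD d _); last first.
  by rewrite /d; rewrite gt_min orbC ltr_pdivrMr// ltr_pMr// ltr1n.
by apply: leeD; apply: le_hausdorff_premeasure; rewrite !ge_min lexx ?orbT.
Qed.

End hausdorff_theory.

(** * Lebesgue measure of boxes *)

Section iterated_integral.
Local Open Scope ereal_scope.
Context (R : realType).
Local Notation lambda := (@lebesgue_measure R).

(* Induction on m: integrate the inequality over the last coordinate. *)
Lemma prod_lebesgue_le_cover (m : nat) (A : nat -> set R)
    (I : nat -> nat -> set R) (w : nat -> \bar R) :
  (forall i, measurable (A i)) -> (forall k i, measurable (I k i)) ->
  (forall k, 0 <= w k) ->
  (forall x : nat -> R, (forall i, (i < m)%N -> A i (x i)) ->
    1 <= \sum_(k <oo) w k * \prod_(i < m) (\1_(I k i) (x i))%:E) ->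
  \prod_(i < m) lambda (A i) <= \sum_(k <oo) w k * \prod_(i < m) lambda (I k i).
Proof.
move=> mA mI; elim: m w => [|m ih] w w0 cov.
  rewrite big_ord0; apply: le_trans (cov (fun=> 0%R) _) _ => //.
  by apply: lee_nneseries => k _; rewrite !big_ord0 ?mule1.
have P0 k : 0 <= \prod_(i < m) lambda (I k i) by apply: prode_ge0.
have ind0 (U : set R) t : 0 <= (\1_U t)%:E :> \bar R by rewrite lee_fin.
rewrite big_ord_recr/=.
have H t : A m t -> \prod_(i < m) lambda (A i) <=
    \sum_(k <oo) (w k * \prod_(i < m) lambda (I k i)) * (\1_(I k m) t)%:E.
  move=> Amt.
  have wt0 k : 0 <= w k * (\1_(I k m) t)%:E by rewrite mule_ge0.
  apply: le_trans (ih (fun k => w k * (\1_(I k m) t)%:E) wt0 _) _.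
    move=> x xA.
    apply: le_trans (cov (fun i => if (i < m)%N then x i else t) _) _.
      move=> i; rewrite ltnS leq_eqVlt => /orP[/eqP->|im].
        by rewrite ltnn.
      by rewrite im; exact: xA.
    apply: lee_nneseries => k _; first by rewrite mule_ge0// prode_ge0.
    rewrite big_ord_recr/= ltnn -!muleA [X in _ <= _ * X]muleC.
    by under eq_bigr do rewrite ltn_ord.
  by under eq_eseriesr do rewrite muleAC.
have mind k : measurable_fun (A m) (fun t => (\1_(I k m) t)%:E : \bar R).
  by apply/measurable_EFinP; apply: measurable_indic; exact: mI.
rewrite -integral_cst; last exact: mA.
apply: (@le_trans _ _ (\int[lambda]_(t in A m) \sum_(k <oo)
    (w k * \prod_(i < m) lambda (I k i)) * (\1_(I k m) t)%:E)).
  apply: ge0_le_integral => //.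
  - exact: mA.
  - move=> x Ax; apply: prode_ge0 => i _; exact: measure_ge0.
  - apply: ge0_emeasurable_sum => [k x _ _|k _]; first by rewrite !mule_ge0.
    apply: emeasurable_funM => //; exact: mind.
rewrite integral_nneseries; last 3 first.
- exact: mA.
- by move=> k; apply: emeasurable_funM => //; exact: mind.
- by move=> k x _; rewrite !mule_ge0.
apply: lee_nneseries => k _.
  by move=> _; apply: integral_ge0 => x _; rewrite !mule_ge0.
rewrite big_ord_recr/= ge0_integralZl; last 4 first.
- exact: mA.
- exact: mind.
- by move=> x _; rewrite ind0.
- by rewrite mule_ge0.
rewrite integral_indic ?muleA; [|exact: mA|exact: mI].
rewrite lee_wpmul2l//; first by rewrite mule_ge0.
apply: le_measure; rewrite ?inE; [|exact: mI|by []].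
by apply: measurableI; [exact: mI|exact: mA].
Qed.

End iterated_integral.

Section boxes.
Context {R : realType} {n : nat}.
Local Notation E := (euclidean R n).
Implicit Types (a b x y p : E) (h c : R).

Lemma mdist_enorm x y : mdist x y = enorm (x - y).
Proof. by []. Qed.

Lemma ecoord_row (f : 'I_n -> R) i : ecoord i (\row_j f j : 'rV[R]_n) = f i.
Proof. by rewrite /ecoord mxE. Qed.

Lemma ecoordB i x y : ecoord i (x - y) = ecoord i x - ecoord i y.
Proof. by rewrite ecoordD ecoordN. Qed.

Lemma box_nonempty a b : (forall i, ecoord i a < ecoord i b) -> box a b a.
Proof. by move=> ab i; rewrite in_itv/= lexx ab. Qed.

Lemma ecoord_box a b x i : box a b x -> ecoord i a < ecoord i b.
Proof. by move=> /(_ i); rewrite in_itv/= => /andP[]; exact: le_lt_trans. Qed.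

Lemma image_ecoord_box a b i : (forall i, ecoord i a < ecoord i b) ->
  ecoord i @` box a b = `[ecoord i a, ecoord i b[%classic.
Proof.
move=> ab; apply/seteqP; split => [_ [x bx <-]|t abt]; first exact: bx.
exists (\row_j (if j == i then t else ecoord j a) : 'rV[R]_n) => [j|].
  rewrite ecoord_row; case: eqP => [->//|_].
  by rewrite in_itv/= lexx ab.
by rewrite ecoord_row eqxx.
Qed.

Lemma box_volumeE a b : (forall i, ecoord i a < ecoord i b) ->
  box_volume (box a b) = (\prod_(i < n) (ecoord i b - ecoord i a))%:E.
Proof.
move=> ab; rewrite /box_volume -prodEFin; apply: eq_bigr => i _.
by rewrite image_ecoord_box// lebesgue_measure_itv/= lte_fin ab EFinB.
Qed.

Let vol (B : set E) : \bar R := if B != set0 then box_volume B else 0%E.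

(** Truncating the sides at 0 makes the product formula valid for empty boxes too, so that cutting a
    box needs no case distinction. *)
Let volE a b :
  vol (box a b) = (\prod_(i < n) Num.max 0 (ecoord i b - ecoord i a))%:E.
Proof.
rewrite /vol; case: ifPn => [/set0P[x bx]|].
  rewrite box_volumeE => [|i]; last exact: ecoord_box bx.
  congr EFin; apply: eq_bigr => i _; rewrite max_r// subr_ge0 ltW//.
  exact: ecoord_box bx.
move=> /negPn/eqP b0.
have [i ba] : exists i, ecoord i b <= ecoord i a.
  apply: contrapT => /forallNP H.
  have : box a b a by apply: box_nonempty => i; rewrite ltNge; exact/negP.
  by rewrite b0.
by rewrite (bigD1 i)//= max_l ?mul0r// subr_le0.
Qed.

Let vol_ge0 B : (0 <= vol B)%E.
Proof. by rewrite /vol; case: ifP => // _; exact: box_volume_ge0. Qed.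

(** The half-space cuts each box of a cover into two boxes, possibly empty, whose volumes add up to
    that of the box. *)
Lemma coord_lt_caratheodory i c :
  (@lebesgue_outer R n).-caratheodory [set x | ecoord i x < c].
Proof.
set H := [set x | _].
apply: le_caratheodory_measurable => Z.
apply: le_ereal_inf_tmp => _ [F [CF ZF] <-].
have boxI a b : exists a1 b1 a2 b2, [/\ box a b `&` H = box a1 b1,
    box a b `&` ~` H = box a2 b2 &
    (vol (box a1 b1) + vol (box a2 b2) = vol (box a b))%E].
  pose b1 : E := \row_j (if j == i then Num.min (ecoord i b) c else ecoord j b).
  pose a2 : E := \row_j (if j == i then Num.max (ecoord i a) c else ecoord j a).
  exists a, b1, a2, b; split.
  - apply/seteqP; split => x.
      move=> [bx xc] j; have := bx j; rewrite !in_itv/= ecoord_row => /andP[-> xb].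
      by case: eqP => [ji|//]; rewrite lt_min -ji xb ji.
    move=> bx; split => [j|]; last first.
      by have := bx i; rewrite in_itv/= ecoord_row eqxx lt_min => /and3P[].
    have := bx j; rewrite !in_itv/= ecoord_row => /andP[->].
    by case: eqP => [->|//]; rewrite lt_min => /andP[].
  - apply/seteqP; split => x.
      move=> [bx /= /negP]; rewrite -leNgt => xc j; have := bx j.
      rewrite !in_itv/= ecoord_row => /andP[ax ->].
      by case: eqP => [ji|//]; rewrite ?ax// ge_max -ji ax ji xc.
    move=> bx; split => [j|]; last first.
      have := bx i; rewrite in_itv/= ecoord_row eqxx ge_max => /andP[/andP[_ cx] _].
      by rewrite /H /= => /(le_lt_trans cx); rewrite ltxx.
    have := bx j; rewrite !in_itv/= ecoord_row => /andP[+ ->].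
    by case: eqP => [->|_ ->//]; rewrite ge_max => /andP[->].
  - rewrite !volE -EFinD; congr EFin.
    rewrite (bigD1 i)//= [X in _ + X](bigD1 i)//= [RHS](bigD1 i)//=.
    rewrite !ecoord_row eqxx.
    rewrite (eq_bigr (fun j => Num.max 0 (ecoord j b - ecoord j a))); last first.
      by move=> j /negPf ji; rewrite ecoord_row ji.
    rewrite [X in _ + _ * X](eq_bigr (fun j => Num.max 0 (ecoord j b - ecoord j a))); last first.
      by move=> j /negPf ji; rewrite ecoord_row ji.
    rewrite -mulrDl; congr (_ * _).
    move: (ecoord i a) (ecoord i b) => u v.
    rewrite /Num.max /Num.min; repeat case: ifPn; rewrite -?leNgt; lra.
have sub (Y : set E) : (forall k, F k `&` Y !=set0 -> exists a b, F k `&` Y = box a b) ->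
    (lebesgue_outer (Z `&` Y) <= \sum_(k <oo) vol (F k `&` Y))%E.
  move=> FY; rewrite -(eseries_mkcond (fun k => box_volume (F k `&` Y))).
  apply: ereal_inf_lbound; exists (fun k => F k `&` Y) => //; split.
    by move=> k /FY[a [b ->]]; exists (a, b).
  by move=> x [Zx Yx]; have [k _ Fkx] := ZF _ Zx; exists k.
have Fbox k : F k !=set0 -> exists a b, F k = box a b.
  by move=> /CF[[a b] _ <-]; exists a, b.
have FH k Y : F k `&` Y !=set0 -> exists a b, F k = box a b.
  by move=> [x [Fx _]]; apply: Fbox; exists x.
apply: (le_trans (leeD (sub H _) (sub (~` H) _))).
- by move=> k /FH[a [b ->]]; have [a1 [b1 [_ [_ [-> _ _]]]]] := boxI a b; exists a1, b1.
- by move=> k /FH[a [b ->]]; have [_ [_ [a1 [b1 [_ -> _]]]]] := boxI a b; exists a1, b1.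
rewrite -nneseriesD// [leRHS]eseries_mkcond; apply: lee_nneseries => [k _|k _].
  by rewrite adde_ge0.
have [->|/set0P/Fbox[a [b Fab]]] := eqVneq (F k) set0.
  by rewrite !set0I /vol eqxx/= adde0.
have [a1 [b1 [a2 [b2 [e1 e2 e3]]]]] := boxI a b.
by rewrite Fab e1 e2 e3 /vol /=; case: ifP => // _; exact: box_volume_ge0.
Qed.

(** The indicators of a cover sum to at least 1 on the box; integrating them one coordinate at a
    time replaces a compactness argument. *)
Lemma box_le_lebesgue_outer a b : (forall i, ecoord i a < ecoord i b) ->
  ((\prod_(i < n) (ecoord i b - ecoord i a))%:E <= lebesgue_outer (box a b))%E.
Proof.
move=> ab; apply: le_ereal_inf_tmp => _ [F [CF ZF] <-].
pose at_ (f : 'I_n -> set R) (i : nat) : set R := if insub i is Some j then f j else set0.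
have atE f (i : 'I_n) : at_ f i = f i by rewrite /at_ valK.
pose A := at_ (fun i => `[ecoord i a, ecoord i b[%classic).
pose I k := at_ (fun i => if F k != set0 then ecoord i @` F k else set0).
have Fbox k : F k !=set0 -> exists a b, F k = box a b.
  by move=> /CF[[a' b'] _ <-]; exists a', b'.
have mI k i : measurable (I k i).
  rewrite /I /at_; case: insub => // j; case: ifPn => // /set0P Fk0.
  have [a' [b' Fk]] := Fbox _ Fk0; rewrite Fk image_ecoord_box// => l.
  by move: Fk0; rewrite Fk => -[x]; exact: ecoord_box.
have mA i : measurable (A i) by rewrite /A /at_; case: insub.
(* The weight removes the empty members of the cover, which an empty product would count as 1 when
   [n = 0]. *)
pose w k : \bar R := if F k != set0 then 1%E else 0%E.
have w0 k : (0 <= w k)%E by rewrite /w; case: ifP.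
have H := @prod_lebesgue_le_cover R n A I w mA mI w0.
rewrite -prodEFin (eq_bigr (fun i : 'I_n => lebesgue_measure (A i))); last first.
  by move=> i _; rewrite /A atE lebesgue_measure_itv/= lte_fin ab ?EFinB.
apply: le_trans (H _) _.
  move=> x xA.
  have t0 j : (0 <= w j * \prod_(i < n) (\1_(I j i) (x i))%:E)%E.
    by rewrite mule_ge0// prode_ge0// => i _; rewrite lee_fin.
  pose y : E := \row_j x j.
  have by_ : box a b y.
    by move=> i; have := xA i (ltn_ord i); rewrite /A atE /= ecoord_row.
  have [k _ Fky] := ZF _ by_.
  have Fk0 : F k != set0 by apply/set0P; exists y.
  apply: le_trans (nneseries_lim_ge k.+1 _).
    have wk : w k = 1%E by rewrite /w Fk0.
    rewrite big_nat_recr//= wk mul1e [X in (_ <= _ + X)%E]big1.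
      rewrite leeDr//; apply: sume_ge0 => j _; exact: t0.
    move=> i _; rewrite /I atE Fk0 indicE mem_set//; exists y => //.
    by rewrite ecoord_row.
  by move=> j _ _; exact: t0.
rewrite [leRHS]eseries_mkcond; apply: lee_nneseries => k _.
  by rewrite mule_ge0// prode_ge0.
rewrite /w; case: ifPn => Fk0; last by rewrite mul0e.
by rewrite mul1e; under eq_bigr do rewrite /I atE Fk0.
Qed.

Lemma lebesgue_outer_box a b : (forall i, ecoord i a < ecoord i b) ->
  lebesgue_outer (box a b) = (\prod_(i < n) (ecoord i b - ecoord i a))%:E.
Proof.
move=> ab; apply/eqP; rewrite eq_le box_le_lebesgue_outer// andbT -box_volumeE//.
by apply: cover_measure_le; [exists (a, b)|exact: box_volume_ge0].
Qed.

End boxes.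

(** * Euclidean norm, cubes and subdivision of the unit interval *)

Section euclidean_norm.
Context {R : realType} {n : nat}.
Local Notation E := (euclidean R n).
Implicit Types (x y e : E) (h t : R).

Lemma enormZ t x : enorm (t *: x) = `|t| * enorm x.
Proof.
rewrite /enorm -sqrtr_sqr -sqrtrM ?sqr_ge0// mulr_sumr; congr Num.sqrt.
by apply: eq_bigr => i _; rewrite ecoordZ exprMn.
Qed.

Lemma ecoord_le_enorm i x : `|ecoord i x| <= enorm x.
Proof.
rewrite -sqrtr_sqr ler_wsqrtr// (bigD1 i)//= lerDl.
by apply: sumr_ge0 => j _; exact: sqr_ge0.
Qed.

Lemma enorm_le_ecoord h x : (forall i, `|ecoord i x| <= h) ->
  enorm x <= n%:R * h.
Proof.
move=> xh; have [n0|n0] := posnP n.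
  move: x xh; rewrite n0 => x xh.
  by rewrite mul0r /enorm big_ord0 sqrtr0.
have h0 : 0 <= h by apply: le_trans (xh (Ordinal n0)).
rewrite -[leRHS]ger0_norm ?mulr_ge0// -sqrtr_sqr ler_wsqrtr//.
apply: (@le_trans _ _ (\sum_(i < n) h ^+ 2)).
  apply: ler_sum => i _; rewrite -[ecoord i x ^+ 2]real_normK ?num_real//.
  by rewrite ler_sqr ?nnegrE.
rewrite sumr_const card_ord -[leLHS]mulr_natl exprMn ler_wpM2r ?sqr_ge0//.
by rewrite expr2 ler_peMl// ler1n.
Qed.

Lemma mdist_line x e t t' : enorm e = 1 ->
  mdist (x + t *: e) (x + t' *: e) = `|t - t'|.
Proof.
move=> e1; rewrite mdist_enorm opprD addrACA subrr add0r -scalerBl.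
by rewrite enormZ e1 mulr1.
Qed.

Lemma mdist_rotate x e e' t : mdist (x + t *: e) (x + t *: e') = `|t| * mdist e e'.
Proof.
by rewrite !mdist_enorm opprD addrACA subrr add0r -scalerBr enormZ.
Qed.

End euclidean_norm.

Section cubes.
Context {R : realType} {n : nat}.
Local Notation E := (euclidean R n).
Implicit Types (x y p e : E) (h t : R).

Definition cube p h : set E :=
  box (\row_i (ecoord i p - h) : 'rV[R]_n) (\row_i (ecoord i p + h) : 'rV[R]_n).

Lemma cubeP p h y :
  cube p h y <-> forall i, - h <= ecoord i (y - p) < h.
Proof.
split => yp i; have := yp i; rewrite ecoordB in_itv/= !ecoord_row; lra.
Qed.

Lemma mdist_cube p h y : mdist y p < h -> cube p h y.
Proof.
rewrite mdist_enorm => yp; apply/cubeP => i.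
have := le_lt_trans (ecoord_le_enorm i (y - p)) yp.
by rewrite ltr_norml => /andP[/ltW -> ->].
Qed.

Lemma cube_mdist p h y : cube p h y -> mdist y p <= n%:R * h.
Proof.
move=> /cubeP yp; rewrite mdist_enorm; apply: enorm_le_ecoord => i.
by rewrite ler_norml; have /andP[-> /ltW ->] := yp i.
Qed.

Lemma lebesgueE (A : set E) : lebesgue n A = lebesgue_outer A.
Proof. by []. Qed.

Lemma lebesgue_cube p h : 0 < h -> lebesgue n (cube p h) = ((2 * h) ^+ n)%:E.
Proof.
move=> h0; rewrite lebesgueE /cube lebesgue_outer_box => [|i]; last by rewrite !ecoord_row; lra.
rewrite (eq_bigr (fun=> 2 * h)) ?prodr_const ?card_ord// => i _.
by rewrite !ecoord_row; ring.
Qed.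

Lemma measurable_cube p h :
  measurable (cube p h : set (caratheodory_type (@lebesgue_outer R n))).
Proof.
pose H i c : set (caratheodory_type (@lebesgue_outer R n)) :=
  [set x | ecoord i (x : E) < c].
rewrite (_ : cube p h = \bigcap_(i in [set: 'I_n])
    (~` H i (ecoord i p - h) `&` H i (ecoord i p + h))).
  apply: fin_bigcap_measurable => // i _.
  apply: measurableI; last exact: coord_lt_caratheodory.
  by apply: measurableC; exact: coord_lt_caratheodory.
apply/seteqP; split => x.
  move=> xp i _; have := xp i; rewrite in_itv/= !ecoord_row => /andP[h1 h2].
  by split => //=; apply/negP; rewrite -leNgt.
move=> xp i; have [/= /negP] := xp i I.
by rewrite in_itv/= !ecoord_row -leNgt => -> ->.
Qed.

End cubes.

Lemma truncn_piece {R : realType} (N : nat) (t : R) : (0 < N)%N -> 0 <= t <= 1 ->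
  exists2 j : nat, (j < N)%N & j%:R * N%:R^-1 <= t <= j.+1%:R * N%:R^-1.
Proof.
move=> N0 /andP[t0 t1].
have NR : 0 < N%:R :> R by rewrite ltr0n.
have [t1'|t1'] := ltP t 1.
  have tN : 0 <= t * N%:R by rewrite mulr_ge0// ltW.
  have /andP[jt tj] := truncn_itv tN.
  exists (Num.truncn (t * N%:R)).
    by rewrite -(ltr_nat R) (le_lt_trans jt)// gtr_pMl.
  by rewrite ler_pdivrMr// jt/= ler_pdivlMr// ltW.
(* Only [t = 1] arrives here: its truncation would be [N], so it goes to the last piece. *)
exists N.-1; first by rewrite prednK.
rewrite prednK// divff ?gt_eqF// t1 andbT ler_pdivrMr//.
apply: le_trans (ler_wpM2r (ltW NR) t1').
by rewrite mul1r ler_nat leq_pred.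
Qed.

(** * Lower bounds for the Kakeya maximal function *)

Section tubes.
Context {R : realType} {n : nat}.
Local Notation E := (euclidean R n).
Implicit Types (x y p e : E) (h t delta : R).

Lemma segment_neq0 e x : segment e x !=set0.
Proof.
by exists (x + 0 *: e), 0 => //=; rewrite in_itv/= lexx ler01.
Qed.

Lemma tube_mdist delta e x y z : segment e x z -> mdist y z <= delta ->
  tube delta e x y.
Proof.
move=> sz yz; rewrite /tube/=; apply: le_trans yz; apply: ge_inf.
  by exists 0 => _ [w _ <-]; exact: mdist_ge0.
by exists z.
Qed.

(** The infimum defining the tube is not shown to be attained; doubling the radius makes the
    inequality strict and yields a witness. *)
Lemma tube_exists delta e x y : 0 < delta -> tube delta e x y ->
  exists2 z, segment e x z & mdist y z < 2 * delta.
Proof.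
move=> d0 yT; have [||_ [z sz <-] yz] := @inf_lt R
    [set mdist y z | z in segment e x] (2 * delta); last by exists z.
- by have [z sz] := segment_neq0 e x; exists (mdist y z), z.
- by apply: (le_lt_trans yT); lra.
Qed.

(** A point of the tube is within [2 / N] of the segment, and the point found there is within
    [1 / N] of one of [N] equally spaced points: hence the half-side [3 / N]. *)
Lemma lebesgue_tube_le (N : nat) e x : (0 < N)%N -> enorm e = 1 ->
  (lebesgue n (tube N%:R^-1%R e x) <= (N%:R * (6 * N%:R^-1) ^+ n)%:E)%E.
Proof.
move=> N0 e1; set delta := N%:R^-1.
have NR : 0 < N%:R :> R by rewrite ltr0n.
have d0 : 0 < delta by rewrite invr_gt0.
have dN : delta * N%:R = 1 by rewrite mulVf ?gt_eqF.
pose Q j := cube (x + (j%:R * delta) *: e) (3 * delta).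
have TQ : tube delta e x `<=` \big[setU/set0]_(j < N) Q j.
  move=> y /(tube_exists d0)[_ [t /= t01 <-] yz].
  move: t01; rewrite in_itv/= => t01.
  have [j jN /andP[j1 j2]] := truncn_piece N0 t01.
  have jt : `|t - j%:R * delta| <= delta.
    by move: j1 j2; rewrite -natr1 mulrDl mul1r -/delta ler_distl; lra.
  rewrite -bigcup_mkord; exists j => //=; apply: mdist_cube.
  apply: le_lt_trans (metric_triangle y (x + t *: e) _) _.
  by rewrite mdist_line//; lra.
have QE j : lebesgue_outer (Q j) = ((6 * delta) ^+ n)%:E.
  by rewrite -lebesgueE lebesgue_cube ?mulr_gt0//; congr (_ ^+ _)%:E; ring.
apply: (@le_trans _ _ (\sum_(j < N) lebesgue_outer (Q j))%E); last first.
  rewrite (eq_bigr (fun=> ((6 * delta) ^+ n)%:E)) => [|j _]; last exact: QE.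
  by rewrite sumEFin lee_fin sumr_const card_ord -[leLHS]mulr_natl.
rewrite lebesgueE; apply: le_trans (le_outer_measure _ _ _ TQ) _.
exact: outer_measure_subadditive.
Qed.

(* N cubes of half-side 3/N cover the tube, while N disjoint cubes of half-side
   1/(4nN) centred on the segment in direction e lie in it: hence (12n)^-n. *)
Lemma kakeya_maximal_ge (N : nat) e e' x (f : E -> R) (v : nat -> R) :
  (0 < n)%N -> (0 < N)%N -> enorm e = 1 -> enorm e' = 1 ->
  mdist e e' <= N%:R^-1 / 4 -> (forall j, 0 <= v j) ->
  (forall j y, (j < N)%N -> mdist y (x + (j%:R * N%:R^-1) *: e) <= N%:R^-1 ->
    v j <= `|f y|) ->
  (((12 * n%:R)^-1 ^+ n * N%:R^-1 * \sum_(j < N) v j)%:E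
    <= kakeya_maximal N%:R^-1%R f e')%E.
Proof.
move=> n0 N0 e1 e'1 ee' v0 vf; set delta := N%:R^-1.
have nR : 0 < n%:R :> R by rewrite ltr0n.
have NR : 0 < N%:R :> R by rewrite ltr0n.
have d0 : 0 < delta by rewrite invr_gt0.
have dN : delta * N%:R = 1 by rewrite mulVf ?gt_eqF.
(* By the crude norm bound, a cube of this half-side lies within [delta / 4] of its centre. *)
pose h := delta / (4 * n%:R).
have h0 : 0 < h by rewrite divr_gt0// mulr_gt0.
have nh : n%:R * h = delta / 4 by rewrite /h; field; rewrite gt_eqF.
pose p j := x + (j%:R * delta) *: e.
pose Q j := cube (p j) h.
have Qdist j y : Q j y -> mdist y (p j) <= delta / 4.
  by move=> /cube_mdist; rewrite nh.
(* Turning the direction from [e] to [e'] moves the centre by at most [mdist e e' <= delta / 4],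
   since its parameter is at most 1. *)
have Qtube j y : (j < N)%N -> Q j y -> tube delta e' x y.
  move=> jN /Qdist yp.
  have jd0 : 0 <= j%:R * delta by rewrite mulr_ge0// ltW.
  have jd1 : j%:R * delta <= 1.
    have : j%:R <= N%:R :> R by rewrite ler_nat ltnW.
    by move=> /(ler_wpM2r (ltW d0)); rewrite [leRHS]mulrC dN.
  apply: (@tube_mdist _ _ _ _ (x + (j%:R * delta) *: e')).
    by exists (j%:R * delta) => //=; rewrite in_itv/= jd0.
  apply: le_trans (metric_triangle y (p j) _) _.
  rewrite mdist_rotate ger0_norm//.
  have := ler_wpM2l jd0 ee'; have := ler_wpM2r (ltW d0) jd1.
  rewrite -/delta; lra.
(* A common point would put the centres within [delta / 2] of each other, but distinct centres are
   at least [delta] apart. *)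
have Qtriv j l y : Q j y -> Q l y -> j = l.
  move=> /Qdist yj /Qdist yl; apply/eqP; apply/negPn/negP => jl.
  have : mdist (p j) (p l) < delta.
    apply: le_lt_trans (metric_triangle _ y _) _.
    rewrite (metric_sym _ y); lra.
  rewrite mdist_line// -mulrBl normrM (ger0_norm (ltW d0)) gtr_pMl//.
  apply/negP; rewrite -leNgt.
  wlog lj : j l {yj yl} jl / (l < j)%N.
    move=> H; have := jl; rewrite neq_ltn => /orP[jl'|]; last exact: H.
    by rewrite distrC H// eq_sym.
  rewrite -natrB 1?ltnW// ger0_norm// ler1n subn_gt0//.
(* A measurable minorant of the integrand on the tube: by disjointness at most one term is nonzero
   at each point. *)
pose g y := (\sum_(j < N) (v j)%:E * (\1_(Q j) y)%:E)%E.
have mQ j : measurable (Q j : set (caratheodory_type (@lebesgue_outer R n))).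
  exact: measurable_cube.
have intg : (\int[lebesgue n]_y g y =
    ((delta / (2 * n%:R)) ^+ n * \sum_(j < N) v j)%:E)%E.
  rewrite ge0_integral_sum; last 3 first.
  - exact: measurableT.
  - move=> j; apply: emeasurable_funM; first exact: measurable_cst.
    apply/measurable_EFinP.
    exact: measurable_indic.
  - by move=> j y _; rewrite mule_ge0// lee_fin.
  rewrite mulr_sumr -sumEFin; apply: eq_bigr => j _.
  rewrite ge0_integralZl; last 4 first.
  - exact: measurableT.
  - by apply/measurable_EFinP; exact: measurable_indic.
  - by move=> y _; rewrite lee_fin.
  - by rewrite lee_fin.
  rewrite integral_indic// setIT lebesgue_cube// -EFinM mulrC; congr (_ ^+ _ * _)%:E.
  by rewrite /h; field; rewrite gt_eqF.
have gle : (\int[lebesgue n]_y g y <=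
    \int[lebesgue n]_(y in tube delta e' x) `|f y|%:E)%E.
  apply: ge0_le_integral_restrict => [y _|y _|y]; last 1 first.
  - rewrite patch_setT.
    have fT0 : (0 <= ((fun y => `|f y|%:E) \_ (tube delta e' x)) y)%E.
      by apply: erestrict_ge0 => z _; rewrite lee_fin.
    have [[l Ql]|/forallNP nQ] := pselect (exists l : 'I_N, Q l y); last first.
      rewrite /g big1// => j _; rewrite indicE memNset ?mule0//; exact: nQ.
    rewrite /g (bigD1 l)//= big1 ?adde0 => [|j jl]; last first.
      rewrite indicE memNset ?mule0// => Qj; move/negP: jl; apply.
      by apply/eqP/val_inj; exact: Qtriv Qj Ql.
    rewrite patchE mem_set; last exact: Qtube Ql.
    rewrite indicE mem_set// mule1 lee_fin; apply: vf => //.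
    by apply: (le_trans (Qdist _ _ Ql)); rewrite -/delta; lra.
  - by apply: sume_ge0 => j _; rewrite mule_ge0// lee_fin.
  - by rewrite lee_fin.
apply: le_trans (ereal_sup_ubound _); last by exists x.
have T0 : (0 <= lebesgue n (tube delta e' x))%E by exact: outer_measure_ge0.
have Tle := lebesgue_tube_le x N0 e'1.
have N6 : 0 < N%:R * (6 * delta) ^+ n by rewrite mulr_gt0// exprn_gt0// mulr_gt0.
apply: (@le_trans _ _ ((N%:R * (6 * delta) ^+ n)^-1%:E *
    ((delta / (2 * n%:R)) ^+ n * \sum_(j < N) v j)%:E)%E).
  rewrite -EFinM lee_fin le_eqVlt; apply/orP; left; apply/eqP.
  rewrite [RHS]mulrA; congr (_ * _).
  rewrite [in RHS]invfM -[RHS]mulrA [LHS]mulrC; congr (_ * _).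
  rewrite -[X in _ = X * _]exprVn -exprMn; congr (_ ^+ _).
  by field; rewrite !gt_eqF.
apply: lee_pmul.
- by rewrite lee_fin invr_ge0 ltW.
- by rewrite lee_fin mulr_ge0 ?sumr_ge0// exprn_ge0// divr_ge0 ?ltW// mulr_gt0.
- have -> : ((N%:R * (6 * delta) ^+ n)^-1%:E = ((N%:R * (6 * delta) ^+ n)%:E)^-1)%E.
    by rewrite inver gt_eqF.
  by rewrite lee_pV2// inE lee_fin ltW.
- by rewrite -intg.
Qed.

End tubes.

(** * Measurability and integration on the sphere *)

Section sphere.
Context {R : realType} {n : nat}.
Local Notation E := (euclidean R n).

Lemma inf_mdist_lipschitz {X : metricType R} (S : set X) (x y : X) : S !=set0 ->
  inf [set mdist x e | e in S] - inf [set mdist y e | e in S] <= mdist x y.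
Proof.
move=> [e0 Se0]; rewrite lerBlDr -lerBlDl; apply: lb_le_inf.
  by exists (mdist y e0), e0.
move=> _ [e Se <-]; rewrite lerBlDl; apply: le_trans (metric_triangle x y e).
by apply: ge_inf; [exists 0 => _ [w _ <-]; exact: mdist_ge0|exists e].
Qed.

(** The norm and its negative are 1-Lipschitz, so [metric_outer_caratheodory] applies to both, and
    the sphere is what their two strict sublevel sets leave out. *)
Lemma measurable_unit_sphere :
  measurable (unit_sphere : set (caratheodory_type (@hausdorff_measure R E (n%:R - 1)))).
Proof.
pose T := caratheodory_type (@hausdorff_measure R E (n%:R - 1)).
have tri (x y : E) : enorm x - enorm y <= mdist x y.
  by rewrite lerBlDr mdist_enorm; apply: le_trans (enormD _ _); rewrite subrK.
have m1 : measurable ([set x | enorm (x : E) < 1] : set T).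
  by apply: metric_outer_caratheodory => //; exact: hausdorff_metric_outer.
have m2 : measurable ([set x | - enorm (x : E) < - 1] : set T).
  apply: (@metric_outer_caratheodory _ _ _ (fun x : E => - enorm x)).
    exact: hausdorff_metric_outer.
  by move=> x y; rewrite opprK addrC metric_sym.
rewrite (_ : unit_sphere = ~` [set x | enorm (x : E) < 1] `&`
    ~` [set x | - enorm (x : E) < - 1]).
  by apply: measurableI; apply: measurableC.
apply/seteqP; split => [x /= ->|x /= []]; first by rewrite !ltxx; split.
move=> /negP; rewrite -leNgt => h1 /negP; rewrite -leNgt lerN2 => h2.
by apply/eqP; rewrite eq_le h1 h2.
Qed.

(* The integrand need not be measurable: the lower bound is integrated over
   the relatively open rho-neighbourhood of S. *)
Lemma sphere_integral_ge (S : set E) (M : E -> \bar R) (c r rho : R) :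
  S `<=` unit_sphere -> 0 < rho -> 0 <= c -> 0 < r ->
  (forall e e', S e -> unit_sphere e' -> mdist e e' <= rho -> (c%:E <= M e')%E) ->
  ((c `^ r)%:E * hausdorff_measure (n%:R - 1) S <=
   \int[sphere_measure]_(e in unit_sphere) (M e `^ r))%E.
Proof.
move=> Ssph rho0 c0 r0 SM.
have [->|/set0P S0] := eqVneq S set0.
  rewrite outer_measure0 mule0; apply: integral_ge0 => e _.
  exact: poweR_ge0.
pose T := caratheodory_type (@hausdorff_measure R E (n%:R - 1)).
pose phi (x : E) := inf [set mdist x e | e in S].
pose G : set T := [set x | phi x < rho] `&` unit_sphere.
have mG : measurable G.
  apply: measurableI; last exact: measurable_unit_sphere.
  apply: metric_outer_caratheodory; first exact: hausdorff_metric_outer.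
  by move=> x y; exact: inf_mdist_lipschitz.
have SG : S `<=` G.
  move=> x Sx; split; last exact: Ssph.
  apply: le_lt_trans rho0; rewrite -(mdistxx x); apply: ge_inf.
    by exists 0 => _ [w _ <-]; exact: mdist_ge0.
  by exists x.
apply: (@le_trans _ _ ((c `^ r)%:E * sphere_measure G)%E).
  by rewrite lee_wpmul2l ?lee_fin ?powR_ge0//; exact: le_outer_measure.
rewrite -integral_cst//.
apply: ge0_le_integral_restrict => [x _|x _|x].
- by rewrite lee_fin powR_ge0.
- exact: poweR_ge0.
rewrite patchE; case: ifPn => [|_]; last first.
  by apply: erestrict_ge0 => z _; exact: poweR_ge0.
rewrite inE => -[xrho xs]; rewrite patchE mem_set// -poweR_EFin.
have [_ [e Se <-] xe] := inf_lt (let: ex_intro e Se := S0 in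
  ex_intro _ (mdist x e) (ex_intro2 _ _ e Se erefl)) xrho.
have cM : (c%:E <= M x)%E by apply: SM Se _ _ => //; rewrite metric_sym ltW.
apply: gt0_ler_poweR => //; rewrite ?ltW// in_itv/= leey ?lee_fin ?c0//.
by rewrite (le_trans _ cM)// lee_fin.
Qed.

End sphere.

(** * Test functions built from overlapping cubes *)

Section cube_sums.
Context {R : realType} {n : nat}.
Local Notation E := (euclidean R n).

(* The l^s sum of the indicators dominates each of them, like their supremum,
   but its L^s norm is computed exactly, with no control on the overlaps. *)
Lemma Lfun_cube_sum (a : nat -> E) (b : nat -> R) (l s beta : R) :
  0 < l -> 0 < s -> (forall i, 0 <= b i) ->
  (\sum_(i <oo) (b i)%:E <= beta%:E)%E ->
  exists f : E -> R, [/\ f \in Lfun (lebesgue n) s%:E,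
    ('N[lebesgue n]_(s%:E)[EFin \o f] <= ((beta * (2 * l) ^+ n) `^ s^-1)%:E)%E &
    forall i y, cube (a i) l y -> b i `^ s^-1 <= `|f y|].
Proof.
move=> l0 s0 b0 bbeta.
pose T := caratheodory_type (@lebesgue_outer R n).
pose t i (y : T) : \bar R := ((b i)%:E * (\1_(cube (a i) l) y)%:E)%E.
pose F (y : T) : \bar R := (\sum_(i <oo) t i y)%E.
have t0 i y : (0 <= t i y)%E by rewrite mule_ge0// lee_fin.
have mt i : measurable_fun setT (t i).
  apply: emeasurable_funM; first exact: measurable_cst.
  apply/measurable_EFinP.
  by apply: measurable_indic; exact: measurable_cube.
have mF : measurable_fun setT F by apply: ge0_emeasurable_sum.
have F0 y : (0 <= F y)%E by apply: nneseries_ge0.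
have tb i y : (t i y <= (b i)%:E)%E.
  by rewrite /t -EFinM lee_fin indicE; case: (_ \in _); rewrite ?mulr1 ?mulr0.
have Fbeta y : (F y <= beta%:E)%E.
  by apply: le_trans bbeta; exact: lee_nneseries.
(* The bound [beta] makes the series finite everywhere, so passing to [fine] loses nothing. *)
have Ffin y : F y \is a fin_num by rewrite ge0_fin_numE// (le_lt_trans (Fbeta y))// ltry.
have si0 : 0 <= s^-1 by rewrite invr_ge0 ltW.
pose f (y : T) := fine (F y) `^ s^-1.
have mf : measurable_fun setT f.
  apply: (measurableT_comp (measurable_powR _)).
  exact: (measurableT_comp (fine_measurable measurableT)).
have fs y : ((`| (EFin \o f) y | `^ s) = F y)%E.
  rewrite /= ger0_norm ?powR_ge0// -powRrM mulVf ?gt_eqF//.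
  by rewrite powRr1 ?fineK// fine_ge0.
have NF : ('N[lebesgue n]_(s%:E)[EFin \o f] <= ((beta * (2 * l) ^+ n) `^ s^-1)%:E)%E.
  have beta0 : 0 <= beta by rewrite -lee_fin; apply: le_trans (Fbeta 0).
  have IF : (\int[lebesgue n]_y F y <= (beta * (2 * l) ^+ n)%:E)%E.
    rewrite integral_nneseries//.
    apply: (@le_trans _ _ (\sum_(i <oo) ((2 * l) ^+ n)%:E * (b i)%:E)%E); last first.
      rewrite nneseriesZl => [|i _]; last by rewrite lee_fin.
      rewrite (mulrC beta) EFinM lee_wpmul2l// lee_fin exprn_ge0// mulr_ge0// ltW//.
    apply: lee_nneseries => i _; first by move=> _; exact: integral_ge0.
    rewrite ge0_integralZl; last 4 first.
    - exact: measurableT.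
    - by apply/measurable_EFinP/measurable_indic; exact: measurable_cube.
    - by move=> y _; rewrite lee_fin.
    - by rewrite lee_fin.
    by rewrite integral_indic ?setIT ?lebesgue_cube 1?muleC//; exact: measurable_cube.
  have I0 : (0 <= \int[lebesgue n]_y F y)%E by exact: integral_ge0.
  rewrite unlock /Lnorm (eq_integral F) => [|y _]; last exact: fs.
  move: (\int[lebesgue n]_y F y)%E IF I0 => I IF I0.
  rewrite -poweR_EFin; apply: gt0_ler_poweR => //.
  - by rewrite in_itv/= leey I0.
  - by rewrite in_itv/= leey lee_fin mulr_ge0// exprn_ge0// mulr_ge0// ltW.
exists f; split => //.
  rewrite inE; apply/andP; split; rewrite inE//.
  exact: le_lt_trans NF (ltry _).
move=> i y Qy; rewrite ger0_norm ?powR_ge0// ge0_ler_powR ?nnegrE//.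
  by rewrite fine_ge0.
rewrite -lee_fin fineK//; apply: le_trans (nneseries_lim_ge i.+1 _) => //.
rewrite big_nat_recr//= {2}/t indicE mem_set// mule1 leeDr// sume_ge0//.
Qed.

End cube_sums.

(** * Quasisymmetric images of segments *)

Section quasisymmetry.
Context {R : realType} {X Y : metricType R}.
Implicit Types (A B : set X) (g : X -> Y).

(** The product form accepts any upper bound [M] for the ratio of distances. From the homeomorphism
    [eta], nonnegativity and small values at positive arguments are retained. *)
Lemma quasisymmetric_distortion A (B : set Y) g : quasisymmetric_on A B g ->
  exists eta : R -> R, [/\ forall eps, 0 < eps -> exists2 tau, 0 < tau & eta tau <= eps,
    forall t, 0 <= t -> 0 <= eta t &
    forall x y z M, A x -> A y -> A z -> x != z -> 0 <= M ->
      mdist x y <= M * mdist x z ->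
      mdist (g x) (g y) <= eta M * mdist (g x) (g z)].
Proof.
move=> [[h [gAB hBA gh hg _]] [eta [[k [etak kk etaK kK _]] etainc etaqs]]].
have in0 (t : R) : 0 <= t -> t \in `[0, +oo[ by rewrite in_itv/= andbT.
have in0P (t : R) : t \in `[0, +oo[ -> 0 <= t by rewrite in_itv/= andbT.
have eta0 t : 0 <= t -> 0 <= eta t by move=> t0; exact/in0P/etak/in0.
have etale a b : 0 <= a -> a <= b -> eta a <= eta b.
  move=> a0; rewrite le_eqVlt => /orP[/eqP->//|ab]; apply/ltW/etainc => //.
    exact: in0.
  by apply: in0; rewrite ltW// (le_lt_trans a0).
exists eta; split => //.
- move=> eps eps0; have k0 : 0 <= k eps by apply/in0P/kk/in0/ltW.
  have etakE e : 0 <= e -> eta (k e) = e by move=> e0; apply: kK; rewrite inE; exact: in0.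
  exists (k eps); last by rewrite etakE// ltW.
  (* If [k eps = 0], then [eta 0 = eps > 0], while monotonicity gives [eta 0 <= eta (k 0) = 0]. *)
  rewrite lt_neqAle k0 andbT; apply/eqP => keps.
  have kz : 0 <= k 0 by apply/in0P/kk/in0.
  have e0 : eta 0 = eps by rewrite [X in eta X]keps etakE// ltW.
  by have := etale _ _ (lexx 0) kz; rewrite etakE// e0 leNgt eps0.
- move=> x y z M Ax Ay Az xz M0 xyz.
  have xz0 : 0 < mdist x z by rewrite mdist_gt0.
  have gxz : 0 < mdist (g x) (g z).
    rewrite mdist_gt0; apply: contra xz => /eqP gxz.
    by rewrite -(gh x) ?inE// gxz gh ?inE.
  rewrite -ler_pdivrMr//; apply: le_trans (etaqs _ _ _ Ax Ay Az xz) _.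
  apply: etale; first by rewrite divr_ge0 ?mdist_ge0.
  by rewrite ler_pdivrMr.
Qed.

(* The image diameter decays geometrically along the scales p^-j because
   points at all intermediate distances are available for comparison. *)
Lemma quasisymmetric_decay A (eta : R -> R) g (D : R) :
  (forall eps, 0 < eps -> exists2 tau, 0 < tau & eta tau <= eps) ->
  (forall t, 0 <= t -> 0 <= eta t) ->
  (forall x y z M, A x -> A y -> A z -> x != z -> 0 <= M ->
      mdist x y <= M * mdist x z ->
      mdist (g x) (g y) <= eta M * mdist (g x) (g z)) ->
  1 <= D -> (forall x y, A x -> A y -> mdist x y <= D) ->
  (forall x t, A x -> 0 <= t <= 2^-1 -> exists2 z, A z & mdist x z = t) ->
  exists (p : nat) (B : R), [/\ (1 < p)%N, 0 < B & forall j x y, A x -> A y ->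
    mdist x y <= D * p%:R^-1 ^+ j -> mdist (g x) (g y) <= B * 2^-1 ^+ j].
Proof.
move=> eta_small eta0 qs D1 AD perf.
have D0 : 0 < D by rewrite (lt_le_trans ltr01).
have [tau tau0 etatau] := eta_small 2^-1 ltac:(by rewrite invr_gt0).
have half : 0 <= (2^-1 : R) <= 2^-1 by rewrite lexx invr_ge0 ler0n.
have neq x z : mdist x z != 0 -> x != z :> X.
  by apply: contra => /eqP ->; rewrite mdistxx.
have [[x0 Ax0]|/forallNP A0] := pselect (exists x, A x); last first.
  by exists 2, 1; split => // j x y /A0.
have [z0 Az0 xz0] := perf _ _ Ax0 half.
(* Since [mdist x0 y <= D = 2 D * mdist x0 z0], a single reference pair at distance 1/2 bounds the
   whole image. *)
pose B0 := eta (2 * D) * mdist (g x0) (g z0).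
have B00 : 0 <= B0 by rewrite mulr_ge0 ?mdist_ge0// eta0// mulr_ge0// ltW.
have gB0 y : A y -> mdist (g x0) (g y) <= B0.
  move=> Ay; apply: qs => //.
  - by apply: neq; rewrite xz0 invr_eq0.
  - by rewrite mulr_ge0// ltW.
  - by rewrite xz0 mulrAC divff// mul1r AD.
(* Large enough for [2 D / p <= tau], where [eta tau <= 1/2]: each step of the scale halves image
   distances. *)
pose p := (Num.truncn (2 * D / tau)).+2.
have p0 : 0 < p%:R :> R by rewrite ltr0n.
have pD : 2 * D / p%:R <= tau.
  rewrite ler_pdivrMr// [leRHS]mulrC -ler_pdivrMr//.
  apply: ltW; apply: lt_trans (truncnS_gt _) _.
  by rewrite ltr_nat.
exists p, (2 * B0 + 1); split => //.
  by rewrite ltr_wpDl// mulr_ge0.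
elim => [|j ih] x y Ax Ay xy.
  rewrite expr0 mulr1; apply: le_trans (metric_triangle _ (g x0) _) _.
  rewrite (metric_sym (g x)); have := gB0 _ Ax; have := gB0 _ Ay; lra.
have pj1 : p%:R^-1 ^+ j <= 1 :> R.
  by rewrite exprn_ile1 ?invr_ge0 ?ler0n// invf_le1// ler1n.
have pj0 : 0 < p%:R^-1 ^+ j :> R by rewrite exprn_gt0 ?invr_gt0.
(* A comparison point at distance [s] falls under the induction hypothesis because [1 <= D], and
   [D p^-(j+1) = (2 D / p) s <= tau s]. *)
pose s := 2^-1 * p%:R^-1 ^+ j : R.
have s0 : 0 < s by rewrite mulr_gt0 ?invr_gt0.
have [z Az xz] : exists2 z, A z & mdist x z = s.
  by apply: perf => //; rewrite ltW//= ler_piMr ?invr_ge0.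
have zs : mdist (g x) (g z) <= (2 * B0 + 1) * 2^-1 ^+ j.
  apply: ih => //; rewrite xz ler_wpM2r ?(ltW pj0)// (le_trans _ D1)//.
  by rewrite invf_le1// ler1n.
have : mdist (g x) (g y) <= eta tau * mdist (g x) (g z).
  apply: qs => //; last 2 first.
  - exact: ltW.
  - apply: (le_trans xy); rewrite xz.
    have -> : D * p%:R^-1 ^+ j.+1 = 2 * D / p%:R * s.
      by rewrite /s exprS; field; rewrite gt_eqF.
    by rewrite ler_wpM2r// ltW.
  - by apply: neq; rewrite xz gt_eqF.
move=> /le_trans; apply.
rewrite exprS mulrCA; apply: ler_pM => //; first by rewrite eta0// ltW.
exact: mdist_ge0.
Qed.

(** The diameter of [A] lies in [(D p^-(k+1), D p^-k]], phrased with points to avoid a supremum. *)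
Definition at_scale (D : R) (p k : nat) A :=
  (forall x y, A x -> A y -> mdist x y <= D * p%:R^-1 ^+ k) /\
  (exists x y, [/\ A x, A y & D * p%:R^-1 ^+ k.+1 < mdist x y]).

Lemma at_scale_exists A (D : R) (p : nat) : (1 < p)%N -> 0 < D ->
  (forall x y, A x -> A y -> mdist x y <= D) ->
  (exists x y, [/\ A x, A y & x != y]) ->
  exists k, at_scale D p k A.
Proof.
move=> p1 D0 AD [x0 [y0 [Ax0 Ay0 xy0]]].
pose P k := `[< exists x y, [/\ A x, A y & D * p%:R^-1 ^+ k.+1 < mdist x y] >].
have rho0 : 0 < mdist x0 y0 by rewrite mdist_gt0.
have exP : exists k, P k.
  exists (Num.truncn (D / mdist x0 y0)); apply/asboolP; exists x0, y0; split => //.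
  rewrite exprVn ltr_pdivrMr ?exprn_gt0 ?ltr0n 1?ltnW// mulrC -ltr_pdivrMr//.
  apply: lt_trans (truncnS_gt _) _; rewrite -natrX ltr_nat.
  exact: ltn_expl.
case: (ex_minnP exP) => k /asboolP Pk kmin; exists k; split => // x y Ax Ay.
case: k => [|k] in Pk kmin *; first by rewrite expr0 mulr1 AD.
rewrite leNgt; apply/negP => xy.
suff /kmin : P k by rewrite ltnn.
by apply/asboolP; exists x, y.
Qed.

End quasisymmetry.

(** * Pieces of a segment against a cover of its image *)

Section covering.
Context {R : realType} {n : nat} {Y : metricType R}.
Local Notation E := (euclidean R n).
Variables (K : set E) (g : E -> Y) (eta : R -> R) (D B : R) (p : nat).
Hypotheses (eta0 : forall t, 0 <= t -> 0 <= eta t)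
  (qs : forall x y z M, K x -> K y -> K z -> x != z -> 0 <= M ->
      mdist x y <= M * mdist x z ->
      mdist (g x) (g y) <= eta M * mdist (g x) (g z))
  (D1 : 1 <= D) (KD : forall x y, K x -> K y -> mdist x y <= D)
  (p1 : (1 < p)%N) (B0 : 0 < B)
  (decay : forall j x y, K x -> K y ->
    mdist x y <= D * p%:R^-1 ^+ j -> mdist (g x) (g y) <= B * 2^-1 ^+ j).

(* A stand-in for the diameter of V `&` g @` K at scale k: it bounds the
   distances there and inherits the geometric decay. *)
Definition cap_diameter (V : set Y) (k : nat) : R :=
  Num.min (fine (diameter V)) (B * 2^-1 ^+ k).

Lemma mdist_le_diameter (V : set Y) d y y' : (diameter V <= d%:E)%E ->
  V y -> V y' -> mdist y y' <= fine (diameter V).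
Proof.
move=> Vd Vy Vy'.
have yV : ((mdist y y')%:E <= diameter V)%E.
  by apply: ereal_sup_ubound; exists (y, y').
rewrite -lee_fin fineK// fin_numElt (le_lt_trans Vd (ltry _)) andbT.
exact: lt_le_trans (ltNyr _) yV.
Qed.

Lemma cap_diameter_ge0 (V : set Y) k d : V !=set0 -> (diameter V <= d%:E)%E ->
  0 <= cap_diameter V k.
Proof.
move=> [y Vy] Vd; rewrite le_min mulr_ge0 ?exprn_ge0 ?invr_ge0 ?(ltW B0)// andbT.
by rewrite -(mdistxx y); exact: mdist_le_diameter Vd _ _.
Qed.

(** One of two far points of the preimage, called [z], is farther than [D p^-(k+1) / 2] from [x]. As
    [1 <= D], [mdist x y] is at most [2 p] times [mdist x z], and [mdist (g x) (g z)] is below both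
    entries of the minimum. *)
Lemma mdist_image_piece (V : set Y) k d x y : (diameter V <= d%:E)%E ->
  at_scale D p k (K `&` g @^-1` V) -> K x -> V (g x) -> K y ->
  mdist x y <= p%:R^-1 ^+ k ->
  mdist (g x) (g y) <= eta (2 * p%:R) * cap_diameter V k.
Proof.
move=> Vd [Ak [a [b [[Ka Va] [Kb Vb] ab]]]] Kx Vx Ky xy.
have pR : 0 < p%:R :> R by rewrite ltr0n ltnW.
have [z [Kz Vz xz]] : exists z, [/\ K z, V (g z) &
    D * p%:R^-1 ^+ k.+1 / 2 < mdist x z].
  have [xa|xa] := ltP (D * p%:R^-1 ^+ k.+1 / 2) (mdist x a); first by exists a.
  exists b; split => //; have := metric_triangle a x b.
  by rewrite (metric_sym a x); lra.
have pk0 : 0 < p%:R^-1 ^+ k :> R by rewrite exprn_gt0 ?invr_gt0.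
have xz0 : 0 < mdist x z.
  apply: lt_trans xz; rewrite divr_gt0// mulr_gt0 ?exprn_gt0 ?invr_gt0//.
  exact: lt_le_trans D1.
apply: (@le_trans _ _ (eta (2 * p%:R) * mdist (g x) (g z))).
  apply: qs => //; first by rewrite -mdist_gt0.
  apply: (le_trans xy).
  apply: (@le_trans _ _ (2 * p%:R * (D * p%:R^-1 ^+ k.+1 / 2))).
    rewrite (_ : _ * _ = D * p%:R^-1 ^+ k); first by rewrite ler_peMl// ltW.
    by rewrite exprS; field; rewrite gt_eqF.
  by rewrite ler_wpM2l ?mulr_ge0 ?(ltW xz)// ltW.
rewrite ler_wpM2l ?eta0 ?mulr_ge0 ?(ltW pR)// le_min.
by rewrite (mdist_le_diameter Vd)//= decay// Ak.
Qed.

(** Each image point lies in some [F i]. If the preimage of [F i] has two points it has a scale [k],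
    and the image point is charged to the piece of length [p^-k] it comes from. Subadditivity and
    [geometric_pigeonhole] select one scale. *)
Lemma segment_scale_bound (u q rho d : R) (F : (set Y)^nat) (e x : E) :
  0 < u -> 0 < q < 1 -> 0 < rho ->
  (forall i, F i !=set0 -> (diameter (F i) <= d%:E)%E) ->
  g @` K `<=` \bigcup_i F i -> 2 * eta (2 * p%:R) * d <= rho ->
  enorm e = 1 -> segment e x `<=` K ->
  (rho%:E < hausdorff_premeasure u rho (g @` segment e x))%E ->
  exists k (w : nat -> R), [/\ forall j, 0 <= w j,
    rho * (1 - q) * q ^+ k <
      \sum_(j < p ^ k) (2 * eta (2 * p%:R) * w j) `^ u &
    forall j, (j < p ^ k)%N -> w j = 0 \/ exists i z,
      [/\ at_scale D p k (K `&` g @^-1` (F i)), K z, F i (g z),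
        w j = cap_diameter (F i) k &
        mdist z (x + (j%:R * (p ^ k)%:R^-1) *: e) <= (p ^ k)%:R^-1]].
Proof.
move=> u0 q01 rho0 Fd KF Hd e1 LK rhoL.
set H := eta (2 * p%:R) in Hd *.
have H0 : 0 <= H by rewrite /H eta0// mulr_ge0// ler0n.
pose delta k : R := (p ^ k)%:R^-1.
have deltaE k : delta k = p%:R^-1 ^+ k by rewrite /delta natrX exprVn.
have pk0 k : (0 < p ^ k)%N by rewrite expn_gt0 ltnW.
have d0 k : 0 < delta k by rewrite invr_gt0 ltr0n.
pose A i := K `&` g @^-1` (F i).
pose J k j := [set x + t *: e | t in `[j%:R * delta k, j.+1%:R * delta k]].
have JL k j : (j < p ^ k)%N -> J k j `<=` segment e x.
  move=> jp _ [t /= + <-]; rewrite in_itv/= => /andP[t0 t1].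
  exists t => //=; rewrite in_itv/= (le_trans _ t0) ?mulr_ge0 ?(ltW (d0 k))//=.
  by apply: (le_trans t1); rewrite ler_pdivrMr ?ltr0n// mul1r ler_nat.
have Jd k j y y' : J k j y -> J k j y' -> mdist y y' <= delta k.
  move=> [t /= + <-] [t' /= + <-]; rewrite !in_itv/= => /andP[t0 t1] /andP[t0' t1'].
  rewrite mdist_line// ler_norml.
  have : j.+1%:R * delta k - j%:R * delta k = delta k.
    by rewrite -mulrBl -natrB// subSnn mul1r.
  by lra.
pose good k j i := (j < p ^ k)%N /\ exists z, [/\ at_scale D p k (A i), A i z & J k j z].
(* Each piece picks one index meeting it at this scale, or the value 0 if there is none; one index
   already controls the image of the whole piece. *)
have [w wP] : exists w : nat -> nat -> R, forall k j,
    (w k j = 0 /\ forall i, ~ good k j i) \/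
    (exists i, good k j i /\ w k j = cap_diameter (F i) k).
  have /choice[w wP] : forall kj : nat * nat, exists r : R,
      (r = 0 /\ forall i, ~ good kj.1 kj.2 i) \/
      (exists i, good kj.1 kj.2 i /\ r = cap_diameter (F i) kj.1).
    move=> [k j] /=; have [[i gi]|/forallNP ng] := pselect (exists i, good k j i).
      by exists (cap_diameter (F i) k); right; exists i.
    by exists 0; left.
  by exists (fun k j => w (k, j)) => k j; exact: wP (k, j).
have AF i z : A i z -> F i !=set0 by move=> [_ Fz]; exists (g z).
have w0 k j : 0 <= w k j.
  have [[->//]|[i [[_ [z [_ Az _]]] ->]]] := wP k j.
  by apply: cap_diameter_ge0 (AF _ _ Az) (Fd _ _); exact: AF Az.
have goodw k j : (exists i, good k j i) -> (hausdorff_premeasure u rho (g @` J k j)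
    <= ((2 * H * w k j) `^ u)%:E)%E.
  move=> [i0 gi0]; have [[_ /(_ i0)//]|[i [[jp [z [Ai Az Jz]]] wE]]] := wP k j.
  have dF := Fd _ (AF _ _ Az).
  have wd : w k j <= d.
    rewrite wE ge_min -lee_fin fineK ?dF//.
    rewrite fin_numElt (le_lt_trans dF (ltry _)) andbT.
    apply: (@lt_le_trans _ _ (mdist (g z) (g z))%:E); first exact: ltNyr.
    by apply: ereal_sup_ubound; exists (g z, g z) => //; case: Az.
  (* The factor 2 comes from joining two image points through [g z]; [w k j <= d] keeps the bound
     below the scale [rho]. *)
  apply: hausdorff_premeasure_le => //.
    rewrite !mulr_ge0//=; apply: le_trans Hd.
    by rewrite ler_wpM2l// mulr_ge0.
  have piece y : J k j y -> mdist (g z) (g y) <= H * w k j.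
    move=> Jy; rewrite wE; case: Az => Kz Fz; apply: mdist_image_piece dF Ai Kz Fz _ _.
      exact/LK/(JL _ _ jp).
    by rewrite -deltaE; exact: Jd Jz Jy.
  move=> _ _ [y Jy <-] [y' Jy' <-]; apply: le_trans (metric_triangle _ (g z) _) _.
  rewrite metric_sym -mulrA mulr_natl mulr2n; exact: lerD (piece _ Jy) (piece _ Jy').
pose Vj k j := if `[< exists i, good k j i >] then g @` J k j else set0.
pose V k := \big[setU/set0]_(j < p ^ k) Vj k j.
(* Images of the preimages with at most one point, which have no scale; they have premeasure 0. *)
pose W i := if `[< exists a b, [/\ A i a, A i b & a != b] >] then set0 else g @` A i.
have LVW : g @` segment e x `<=` \bigcup_k V k `|` \bigcup_i W i.
  move=> _ [y Ly <-].
  have [i _ Fy] := KF _ (ex_intro2 _ _ y (LK _ Ly) erefl).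
  have Ay : A i y by split => //; exact: LK.
  have [ab|nab] := pselect (exists a b, [/\ A i a, A i b & a != b]); last first.
    by right; exists i => //; rewrite /W asboolF//; exists y.
  left.
  have [|k Ai] := at_scale_exists p1 (lt_le_trans ltr01 D1) _ ab.
    by move=> a b [Ka _] [Kb _]; exact: KD.
  move: (Ly) => [t /=]; rewrite in_itv/= => t01 ty.
  have [j jp jt] := truncn_piece (pk0 k) t01.
  have Jy : J k j y by exists t => //=; rewrite in_itv.
  exists k => //; rewrite /V -bigcup_mkord; exists j => //=.
  rewrite /Vj asboolT; first by exists y.
  by exists i; split => //; exists y.
have W0 i : hausdorff_premeasure u rho (W i) = 0%E.
  apply/eqP; rewrite eq_le hausdorff_premeasure_ge0 andbT /W.
  case: asboolP => [_|nab]; first by rewrite outer_measure0.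
  have -> : (0 = (0 `^ u)%:E :> \bar R)%E by rewrite powR0// gt_eqF.
  apply: hausdorff_premeasure_le => //; first by rewrite lexx ltW.
  move=> _ _ [a Aa <-] [b Ab <-].
  have [->|ab] := eqVneq a b; first by rewrite mdistxx.
  by exfalso; apply: nab; exists a, b.
have Vsum : (rho%:E < \sum_(k <oo) hausdorff_premeasure u rho (V k))%E.
  apply: (lt_le_trans rhoL); apply: le_trans (le_outer_measure _ _ _ LVW) _.
  apply: le_trans (outer_measureU2 _ _ _) _.
  rewrite -[leRHS]adde0; apply: leeD.
    exact: outer_measure_sigma_subadditive.
  apply: le_trans (outer_measure_sigma_subadditive _ _) _.
  by rewrite eseries0 => [//|i _ _]; exact: W0.
have [k kV] := geometric_pigeonhole (ltW rho0) q01
  (fun k => hausdorff_premeasure_ge0 u rho (V k)) Vsum.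
exists k, (w k); split => //.
  rewrite -lte_fin; apply: (lt_le_trans kV).
  rewrite -sumEFin; apply: le_trans (outer_measure_subadditive _ (Vj k) (p ^ k)%N) _.
  apply: lee_sum => j _; rewrite /Vj; case: asboolP => [|_]; first exact: goodw.
  by rewrite outer_measure0 lee_fin powR_ge0.
move=> j jp; have [[->]|[i [[_ [z [Ai [Kz Fz] Jz]]] wE]]] := wP k j; first by left.
right; exists i, z; split => //; apply: Jd Jz _.
by exists (j%:R * delta k) => //=; rewrite in_itv/= lexx/= ler_wpM2r ?(ltW (d0 k))// ler_nat.
Qed.

End covering.

(** * The maximal inequality at one scale *)

Section one_scale.
Context {R : realType} {n : nat} {Y : metricType R}.
Local Notation E := (euclidean R n).

(** The test function has height at least [N cap^u] on cubes around the preimages at scale [k], so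
    its tube averages dominate the sums of [w j ^ u]. Here [eta] bounds the covering sum and is not
    a distortion function. *)
Lemma kakeya_scale_inequality (K : set E) (g : E -> Y) (D B : R) (p k : nat)
    (u r s t d eta A c h : R) (F : (set Y)^nat) (S : set E) :
  (0 < n)%N -> 0 < u -> 0 < r -> 0 < s -> 0 <= t < s * u -> (1 < p)%N ->
  1 <= D -> 0 < B -> (forall x y, K x -> K y -> mdist x y <= D) ->
  (forall i, F i !=set0 -> (diameter (F i) <= d%:E)%E) ->
  (\sum_(i <oo | F i != set0) diameter (F i) `^ t <= eta%:E)%E ->
  S `<=` unit_sphere ->
  0 <= c -> 0 <= h -> (h%:E <= hausdorff_measure (n%:R - 1) S)%E -> 0 <= A ->
  (forall f : E -> R, f \in Lfun (lebesgue n) s%:E ->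
    ((\int[sphere_measure]_(e in unit_sphere)
       (kakeya_maximal (p ^ k)%:R^-1%R f e) `^ r) `^ r^-1
     <= A%:E * 'N[lebesgue n]_(s%:E)[EFin \o f])%E) ->
  (forall e, S e -> exists x (w : nat -> R), [/\ forall j, 0 <= w j,
    c <= \sum_(j < p ^ k) w j `^ u &
    forall j, (j < p ^ k)%N -> w j = 0 \/ exists i z,
      [/\ at_scale D p k (K `&` g @^-1` (F i)), K z, F i (g z),
        w j = cap_diameter B (F i) k &
        mdist z (x + (j%:R * (p ^ k)%:R^-1) *: e) <= (p ^ k)%:R^-1]]) ->
  (12 * n%:R)^-1 ^+ n * c * h `^ r^-1 <=
  A * ((p ^ k)%:R `^ s * (B * 2^-1 ^+ k) `^ (s * u - t) * eta *
       (2 * ((D + 3) * (p ^ k)%:R^-1)) ^+ n) `^ s^-1.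
Proof.
move=> n0 u0 r0 s0 /andP[t0 tsu] p1 D1 B0 KD Fd Feta Ssph c0 h0 hS A0 hC hS'.
set N := (p ^ k)%N; set delta := N%:R^-1.
have N0 : (0 < N)%N by rewrite expn_gt0 ltnW.
have NR : 0 < N%:R :> R by rewrite ltr0n.
have d0 : 0 < delta by rewrite invr_gt0.
have Bk0 : 0 < B * 2^-1 ^+ k by rewrite mulr_gt0// exprn_gt0// invr_gt0.
pose sc i := at_scale D p k (K `&` g @^-1` (F i)).
have scF i : sc i -> F i !=set0 by move=> [_ [x [_ [[_ Fx] _ _]]]]; exists (g x).
have cap0 i : sc i -> 0 <= cap_diameter B (F i) k.
  by move=> si; apply: cap_diameter_ge0 (scF _ si) (Fd _ _) => //; exact: scF.
have /choice[a aP] : forall i, exists x : E, sc i -> K x /\ F i (g x).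
  move=> i; have [si|nsi] := pselect (sc i); last by exists 0.
  by have [_ [x [_ [[Kx Fx] _ _]]]] := si; exists x.
pose b i := if `[< sc i >] then (N%:R * cap_diameter B (F i) k `^ u) `^ s else 0.
have b0 i : 0 <= b i by rewrite /b; case: asboolP => // _; exact: powR_ge0.
pose beta := N%:R `^ s * (B * 2^-1 ^+ k) `^ (s * u - t) * eta.
pose G := N%:R `^ s * (B * 2^-1 ^+ k) `^ (s * u - t).
have G0 : 0 <= G by rewrite mulr_ge0// powR_ge0.
have bbeta : (\sum_(i <oo) (b i)%:E <= beta%:E)%E.
  apply: (@le_trans _ _ (G%:E * \sum_(i <oo | F i != set0) diameter (F i) `^ t)%E); last first.
    by rewrite /beta -/G (EFinM G eta) lee_wpmul2l.
  rewrite -nneseriesZl => [|i _]; last exact: poweR_ge0.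
  rewrite [leRHS]eseries_mkcond.
  apply: lee_nneseries => i _; first by rewrite lee_fin.
  rewrite /b; case: asboolP => [si|_]; last first.
    by case: ifP => // _; rewrite mule_ge0 ?poweR_ge0.
  have Fi := scF _ si; have /set0P -> := Fi.
  have Dfin : diameter (F i) \is a fin_num.
    rewrite fin_numElt (le_lt_trans (Fd _ Fi) (ltry _)) andbT.
    have [y Fy] := Fi; apply: (@lt_le_trans _ _ (mdist y y)%:E); first exact: ltNyr.
    by apply: ereal_sup_ubound; exists (y, y).
  rewrite -(fineK Dfin) poweR_EFin -EFinM lee_fin.
  rewrite powRM ?powR_ge0// -powRrM /G -mulrA ler_wpM2l ?powR_ge0//.
  (* In the splitting [s u = (s u - t) + t], the first power is bounded through [B 2^-k] and the
     second through the diameter. *)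
  rewrite (mulrC u) -{1}(subrK t (s * u)) powRD; last first.
    by rewrite subrK mulf_eq0 (gt_eqF s0) (gt_eqF u0).
  have ci0 := cap0 _ si.
  apply: ler_pM; rewrite ?powR_ge0//; apply: ge0_ler_powR; rewrite ?nnegrE ?(ltW Bk0)//.
  - by rewrite subr_ge0 ltW.
  - by rewrite ge_min lexx orbT.
  - by apply: le_trans ci0 _; rewrite ge_min lexx.
  - by rewrite ge_min lexx.
have l0 : 0 < (D + 3) * delta by rewrite mulr_gt0// addr_gt0// (lt_le_trans ltr01).
have [f [fL fN fb]] := Lfun_cube_sum a l0 s0 b0 bbeta.
have kap0 : 0 <= (12 * n%:R)^-1 ^+ n :> R by rewrite exprn_ge0// invr_ge0 mulr_ge0.
have Mge e e' : S e -> unit_sphere e' -> mdist e e' <= delta / 4 ->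
    (((12 * n%:R)^-1 ^+ n * c)%:E <= kakeya_maximal delta f e')%E.
  move=> Se e'1 ee'; have [x [w [w0 cw wP]]] := hS' _ Se.
  apply: le_trans (kakeya_maximal_ge (v := fun j =>
    if (j < N)%N then N%:R * w j `^ u else 0) n0 N0 (Ssph _ Se) e'1 ee' _ _).
  - rewrite lee_fin -mulrA ler_wpM2l//; apply: (le_trans cw).
    under [X in _ <= _ * X]eq_bigr do rewrite ltn_ord.
    by rewrite -mulr_sumr mulKf// gt_eqF.
  - by move=> j; case: ifP => // _; rewrite mulr_ge0 ?powR_ge0// ltW.
  move=> j y jN yp; rewrite jN.
  have [->|[i [z [si Kz Fz wE zp]]]] := wP j jN.
    by rewrite powR0 ?mulr0// gt_eqF.
  have [Ka Fa] := aP i si.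
  (* [y] is within [2 delta] of [z], and [z] within [D delta] of the centre, both lying in one
     preimage at scale [k]; [D + 3] leaves room for strictness. *)
  have yQ : cube (a i) ((D + 3) * delta) y.
    apply: mdist_cube; apply: le_lt_trans (metric_triangle _ z _) _.
    have za : mdist z (a i) <= D * delta.
      by rewrite /delta natrX -exprVn; apply: si.1.
    have yz : mdist y z <= delta + delta.
      apply: le_trans (metric_triangle _ _ _) (lerD yp _); rewrite metric_sym; exact: zp.
    lra.
  apply: le_trans (fb i y yQ).
  rewrite /b asboolT// wE -powRrM divff ?gt_eqF// powRr1//.
  by rewrite mulr_ge0 ?powR_ge0// ltW.
have kc0 : 0 <= (12 * n%:R)^-1 ^+ n * c by rewrite mulr_ge0.
have d4 : 0 < delta / 4 by rewrite divr_gt0.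
have I1 := sphere_integral_ge Ssph d4 kc0 r0 Mge.
have I2 := hC f fL.
rewrite -lee_fin.
apply: (@le_trans _ _ (A%:E * 'N[lebesgue n]_(s%:E)[EFin \o f])%E); last first.
  by rewrite EFinM lee_wpmul2l.
apply: le_trans I2.
have -> : (12 * n%:R)^-1 ^+ n * c * h `^ r^-1 =
    (((12 * n%:R)^-1 ^+ n * c) `^ r * h) `^ r^-1.
  by rewrite powRM ?powR_ge0// -powRrM divff ?gt_eqF// powRr1.
rewrite -poweR_EFin.
have hI : ((((12 * n%:R)^-1 ^+ n * c) `^ r * h)%:E <=
    \int[sphere_measure]_(e in unit_sphere) (kakeya_maximal delta f e `^ r))%E.
  by apply: le_trans I1; rewrite EFinM lee_wpmul2l// lee_fin powR_ge0.
move: (\int[sphere_measure]_(e in unit_sphere) (kakeya_maximal delta f e `^ r))%E hI => I hI.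
have L0 : 0 <= ((12 * n%:R)^-1 ^+ n * c) `^ r * h by rewrite mulr_ge0// powR_ge0.
apply: gt0_ler_poweR => //; rewrite ?invr_ge0 ?(ltW r0)// in_itv/= leey ?lee_fin ?L0//.
by rewrite (le_trans _ hI)// lee_fin.
Qed.

End one_scale.

(** * Cancellation of the powers of the scale *)

Section exponents.
Context {R : realType}.
Implicit Types (P X W eta s u t eps : R).

(** The factor [P^((n - s) / s)] of the maximal estimate cancels [(P^(s - n))^(1 / s)] from the test
    function, leaving only [P^eps]. *)
Lemma scale_exponents P X W eta s u t eps (n : nat) :
  0 < P -> 0 < X -> 0 < W -> 0 < eta -> 0 < s ->
  P^-1 `^ (- ((n%:R - s) / s) - eps) *
    (P `^ s * X `^ (s * u - t) * eta * (W * P^-1) ^+ n) `^ s^-1 =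
  P `^ eps * X `^ (u - t / s) * (eta * W ^+ n) `^ s^-1.
Proof.
move=> P0 X0 W0 eta0 s0.
have sN0 : s != 0 by rewrite gt_eqF.
have PD a b : P `^ (a + b) = P `^ a * P `^ b.
  by rewrite powRD// (gt_eqF P0) implybT.
have PV : P^-1 = P `^ (-1) by rewrite powR_inv1// ltW.
have -> : P `^ s * X `^ (s * u - t) * eta * (W * P^-1) ^+ n =
    P `^ (s - n%:R) * X `^ (s * u - t) * (eta * W ^+ n).
  rewrite exprMn PD PV -[(P `^ (-1)) ^+ n]powR_mulrn ?powR_ge0// -powRrM mulN1r.
  ring.
have EW0 : 0 <= eta * W ^+ n by rewrite mulr_ge0 ?exprn_ge0// ltW.
rewrite (powRM _ (mulr_ge0 (powR_ge0 _ _) (powR_ge0 _ _)) EW0).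
rewrite (powRM _ (powR_ge0 _ _) (powR_ge0 _ _)).
rewrite PV -!powRrM !mulrA; congr (_ * _).
rewrite -PD; congr (_ `^ _ * _ `^ _); field => //.
Qed.

End exponents.

(** * Reduction to a bounded union of segments, and the conclusion *)

Lemma ereal_gt0_lt {R : realType} (x : \bar R) : (0 < x)%E ->
  exists2 h : R, 0 < h & (h%:E < x)%E.
Proof.
case: x => [x|_|//]; last by exists 1 => //; rewrite ltry.
rewrite lte_fin => x0; exists (x / 2); first by rewrite divr_gt0.
by rewrite lte_fin gtr_pMr// invf_lt1// ltr1n.
Qed.

Lemma outer_measure_gt0_bigcup {R : realType} {T : Type}
    (mu : {outer_measure set T -> \bar R}) (A : set T) (S : (set T)^nat) :
  A `<=` \bigcup_m S m -> (0 < mu A)%E -> exists m, (0 < mu (S m))%E.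
Proof.
move=> AS A0; apply: contrapT => /forallNP S0.
move: A0; apply/negP; rewrite -leNgt.
apply: le_trans (le_outer_measure mu _ _ AS) _.
apply: le_trans (outer_measure_sigma_subadditive mu S) _.
rewrite eseries0// => m _ _; apply/eqP; rewrite eq_le outer_measure_ge0 andbT.
by rewrite leNgt; apply/negP/S0.
Qed.

Section bounded_segments.
Context {R : realType} {n : nat}.
Local Notation E := (euclidean R n).
Variables (K : set E) (M : R).

(** Boundedness provides the top scale [D]; being a union of unit segments provides points at every
    distance up to 1/2 from a given one. *)
Definition bounded_segments : set E :=
  [set z | exists e x, [/\ unit_sphere e, segment e x `<=` K,
    (forall y, segment e x y -> enorm y <= M) & segment e x z]].

Lemma bounded_segments_sub : bounded_segments `<=` K.
Proof. by move=> z [e [x [_ LK _]]]; exact: LK. Qed.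

Lemma bounded_segments_mdist (x y : E) :
  bounded_segments x -> bounded_segments y -> mdist x y <= 2 * M.
Proof.
move=> [e [a [_ _ LM Lx]]] [e' [a' [_ _ LM' Ly]]].
rewrite mdist_enorm; apply: le_trans (enormD _ _) _.
by rewrite enormN mulr_natl mulr2n; apply: lerD; [exact: LM|exact: LM'].
Qed.

Lemma bounded_segments_perfect (x : E) t : bounded_segments x -> 0 <= t <= 2^-1 ->
  exists2 z, bounded_segments z & mdist x z = t.
Proof.
move=> [e [a [e1 LK LM [v /= v01 <-]]]] /andP[t0 t1].
move: v01; rewrite in_itv/= => /andP[v0 v1].
have [w w01 vw] : exists2 w, 0 <= w <= 1 & `|v - w| = t.
  (* Moving towards the farther endpoint leaves room for any displacement up to 1/2. *)
  have [v2|v2] := leP v 2^-1.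
    by exists (v + t); [lra|rewrite opprD addrA subrr sub0r normrN ger0_norm].
  exists (v - t); first lra.
  by rewrite opprB addrCA subrr addr0 ger0_norm.
exists (a + w *: e); last by rewrite mdist_line.
by exists e, a; split => //; exists w => //=; rewrite in_itv.
Qed.

Lemma segment_bounded (e x : E) : unit_sphere e ->
  forall y, segment e x y -> enorm y <= enorm x + 1.
Proof.
move=> e1 _ [t /= + <-]; rewrite in_itv/= => /andP[t0 t1].
by apply: le_trans (enormD _ _) _; rewrite lerD2l enormZ e1 mulr1 ger0_norm.
Qed.

End bounded_segments.

Theorem theorem1p5 (R : realType) (n : nat) (u r s : R)
    (hn : (2 <= n)%N) (hu : 1 <= u) (hr : 0 < r) (hs1 : 1 < s) (hsn : s <= n%:R)
    (hM : forall eps0 : R, 0 < eps0 -> exists2 eps : R, 0 < eps < eps0 &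
      exists C : R, forall f : euclidean R n -> R,
        f \in Lfun (lebesgue n) s%:E ->
        forall delta : R, 0 < delta ->
        ((\int[sphere_measure]_(e in unit_sphere)
            (kakeya_maximal delta f e) `^ r) `^ r^-1
          <= (C * delta `^ (- ((n%:R - s) / s) - eps))%:E
             * 'N[lebesgue n]_(s%:E)[EFin \o f])%E)
    (K : set (euclidean R n)) (hK : kakeya_set K)
    (X : metricType R) (g : euclidean R n -> X)
    (hg : quasisymmetric_on K [set: X] g)
    (hpos : (0 < hausdorff_measure (n%:R - 1)
      [set e : euclidean R n | unit_sphere e /\
        exists x, segment e x `<=` K /\
          0 < hausdorff_measure u (g @` segment e x)])%E) :
  ((s * u)%:E <= hausdorff_dim (g @` K))%E.
Proof.
rewrite leNgt; apply/negP => /ereal_inf_lt[_ [t [t0 Ht0] <-]]; rewrite lte_fin => tsu.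
have u0 : 0 < u by rewrite (lt_le_trans ltr01).
have s0 : 0 < s by rewrite (lt_trans ltr01).
have n0 : (0 < n)%N by rewrite ltnW.
have nR : 0 < n%:R :> R by rewrite ltr0n.
(* One integer bounds the position of the segment and makes the positivity of the measure of its
   image quantitative, at a fixed scale. Countably many such sets exhaust the given directions. *)
pose S m : set (euclidean R n) := [set e | unit_sphere e /\ exists x,
  [/\ segment e x `<=` K, forall y, segment e x y -> enorm y <= m.+1%:R &
    (m.+1%:R^-1%:E < hausdorff_premeasure u m.+1%:R^-1%R (g @` segment e x))%E]].
have [m Sm0] : exists m, (0 < hausdorff_measure (n%:R - 1) (S m))%E.
  apply: outer_measure_gt0_bigcup hpos => e [e1 [x [LK /ereal_sup_gt]]].
  move=> [_ [d d0 <-] /ereal_gt0_lt[h h0 hd]].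
  pose m := Num.truncn (Num.max (enorm x + 1) (Num.max d^-1 h^-1)).
  have := truncnS_gt (Num.max (enorm x + 1) (Num.max d^-1 h^-1)).
  rewrite -/m !gt_max => /and3P[xm dm hm]; exists m => //; split => //; exists x; split => //.
    by move=> y /(segment_bounded e1)/le_trans; apply; exact: ltW.
  have md : m.+1%:R^-1 <= d by rewrite invf_ple ?posrE// ltW.
  have mh : m.+1%:R^-1 <= h by rewrite invf_ple ?posrE// ltW.
  apply: (@le_lt_trans _ _ h%:E); first by rewrite lee_fin.
  by apply: (lt_le_trans hd); exact: le_hausdorff_premeasure.
have [h h0 hSm] := ereal_gt0_lt Sm0.
pose M : R := m.+1%:R; pose rho := M^-1; pose D := 2 * M.
have M1 : 1 <= M by rewrite ler1n.
have rho0 : 0 < rho by rewrite invr_gt0.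
have D1 : 1 <= D by rewrite /D; lra.
pose K' := bounded_segments K M.
have K'K : K' `<=` K by exact: bounded_segments_sub.
have K'D : forall x y, K' x -> K' y -> mdist x y <= D by exact: bounded_segments_mdist.
have [eta [eta_small eta0 qsK]] := quasisymmetric_distortion hg.
have qs x y z a : K' x -> K' y -> K' z -> x != z -> 0 <= a ->
    mdist x y <= a * mdist x z -> mdist (g x) (g y) <= eta a * mdist (g x) (g z).
  by move=> /K'K ? /K'K ? /K'K ?; exact: qsK.
have [p [B [p1 B0 decay]]] := quasisymmetric_decay eta_small eta0 qs D1 K'D
  (@bounded_segments_perfect _ _ K M).
have pR1 : 1 < p%:R :> R by rewrite ltr1n.
(* Adding 1 keeps [H] positive; [d = rho / H] is then small enough for [segment_scale_bound]. *)
pose H := 2 * eta (2 * p%:R) + 1.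
have H1 : 1 <= H.
  by rewrite lerDr mulr_ge0// eta0// mulr_ge0// ler0n.
have H0 : 0 < H by rewrite (lt_le_trans ltr01).
pose d := rho / H.
have d0 : 0 < d by rewrite divr_gt0.
pose sigma := u - t / s.
have sigma0 : 0 < sigma by rewrite subr_gt0 ltr_pdivrMr// mulrC.
have ln2 : 0 < ln 2 :> R by rewrite ln_gt0// ltr1n.
have lnp : 0 < ln p%:R :> R by rewrite ln_gt0.
(* This bound gives [p^eps <= 2^(sigma / 2)]: the loss in the maximal estimate consumes at most half
   of the decay [2^-sigma]. *)
have [eps /andP[eps0 epslt] [C hC]] := hM (sigma / 2 * ln 2 / ln p%:R)
  ltac:(by rewrite divr_gt0 ?mulr_gt0 ?divr_gt0).
(* Solves [q^(1 + 1/r) = 2^(-sigma / 2)]: the pigeonholes cost [q^k] on segments and [(q^k)^(1/r)]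
   on directions, which matches the other half of the decay. *)
pose q := 2 `^ (- (sigma / 2) / (1 + r^-1)) : R.
have r1 : 0 < 1 + r^-1 by rewrite addr_gt0// invr_gt0.
have q01 : 0 < q < 1.
  rewrite powR_gt0//= /q /powR gt_eqF// expR_lt1 pmulr_llt0//.
  by rewrite pmulr_llt0 ?invr_gt0// oppr_lt0 divr_gt0.
have /andP[q0 q1] := q01.
have q1' : 0 < 1 - q by rewrite subr_gt0.
pose kap : R := (12 * n%:R)^-1 ^+ n.
have kap0 : 0 < kap by rewrite exprn_gt0// invr_gt0 mulr_gt0.
(* [lower] and [upper] collect the factors independent of [k] on the two sides; [C] may have any
   sign, hence [|C| + 1] in the latter. *)
pose lower := kap * (rho * (1 - q) / H `^ u) * (h * (1 - q)) `^ r^-1.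
have lower0 : 0 < lower.
  by rewrite !mulr_gt0 ?powR_gt0 ?invr_gt0 ?powR_gt0// mulr_gt0.
pose W := 2 * (D + 3).
have W0 : 0 < W by rewrite mulr_gt0// addr_gt0// (lt_le_trans ltr01).
pose upper := (`|C| + 1) * B `^ sigma * (W ^+ n) `^ s^-1.
have upper0 : 0 < upper.
  by rewrite !mulr_gt0 ?powR_gt0 ?exprn_gt0// ltr_pwDr.
(* Makes [upper * eta1^(1/s)] equal to [lower / 2]. None of the constants depends on the cover,
   which is chosen only afterwards. *)
pose eta1 := (lower / (2 * upper)) `^ s.
have eta10 : 0 < eta1 by rewrite powR_gt0// divr_gt0// mulr_gt0.
have upper_lt : upper * eta1 `^ s^-1 < lower.
  rewrite -powRrM divff ?gt_eqF// powRr1; last first.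
    by apply: divr_ge0; [exact: ltW|apply: mulr_ge0 => //; exact: ltW].
  have half x y : 0 < x -> x * (y / (2 * x)) = y / 2 :> R.
    by move=> x0; field; rewrite gt_eqF.
  rewrite half//.
  by rewrite gtr_pMr// invf_lt1// ltr1n.
have [_ [F [Fd gKF] <-] Feta] : exists2 y, [set (\sum_(k <oo | F k != set0)
    diameter (F k) `^ t)%E | F in
    countable_cover [set U : set X | (diameter U <= d%:E)%E] (g @` K)] y &
    (y < eta1%:E)%E.
  apply: ereal_inf_lt; apply: (@le_lt_trans _ _ 0%E); last by rewrite lte_fin.
  apply: (@le_trans _ _ (hausdorff_measure t (g @` K))); last by rewrite Ht0.
  by apply: ereal_sup_ubound; exists d.
pose good k (e : euclidean R n) (x : euclidean R n) (w : nat -> R) :=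
  [/\ forall j, 0 <= w j,
    rho * (1 - q) / H `^ u * q ^+ k <= \sum_(j < p ^ k) w j `^ u &
    forall j, (j < p ^ k)%N -> w j = 0 \/ exists i z,
      [/\ at_scale D p k (K' `&` g @^-1` (F i)), K' z, F i (g z),
        w j = cap_diameter B (F i) k &
        mdist z (x + (j%:R * (p ^ k)%:R^-1) *: e) <= (p ^ k)%:R^-1]].
pose Sk k : set (euclidean R n) := [set e | unit_sphere e /\ exists x w, good k e x w].
have SSk : S m `<=` \bigcup_k Sk k.
  move=> e [e1 [x [LK LM rhoL]]].
  have LK' : segment e x `<=` K' by move=> z Lz; exists e, x.
  have K'F : g @` K' `<=` \bigcup_i F i.
    by apply: subset_trans gKF; exact: image_subset.
  have Hd : 2 * eta (2 * p%:R) * d <= rho.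
    rewrite /d mulrCA ler_piMr ?(ltW rho0)// ler_pdivrMr// mul1r /H lerDl.
    exact: ler01.
  have [k [w [w0 cw wP]]] := segment_scale_bound eta0 qs D1 K'D p1 B0 decay
    u0 q01 rho0 Fd K'F Hd e1 LK' rhoL.
  exists k => //; split => //; exists x, w; split => //.
  rewrite mulrAC ler_pdivrMr ?powR_gt0//; apply: (le_trans (ltW cw)).
  rewrite mulr_suml; apply: ler_sum => j _.
  rewrite [leRHS]mulrC -powRM ?(ltW H0)//; apply: ge0_ler_powR; rewrite ?nnegrE ?(ltW u0)//.
  - by rewrite !mulr_ge0// eta0// mulr_ge0// ler0n.
  - by rewrite mulr_ge0// ltW.
  - by rewrite ler_wpM2r// /H lerDl.
have hSk : (h%:E < \sum_(k <oo) hausdorff_measure (n%:R - 1) (Sk k))%E.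
  apply: (lt_le_trans hSm); apply: le_trans (le_outer_measure _ _ _ SSk) _.
  exact: outer_measure_sigma_subadditive.
(* The directions are sorted by the scale their segments select, so that a single [k] now serves a
   set of directions of measure above [h (1 - q) q^k]. *)
have [k hk] := geometric_pigeonhole (ltW h0) q01
  (fun k => outer_measure_ge0 (hausdorff_measure (n%:R - 1)) (Sk k)) hSk.
pose P : R := (p ^ k)%:R.
have P0 : 0 < P by rewrite ltr0n expn_gt0 ltnW.
pose A := `|C| * P^-1 `^ (- ((n%:R - s) / s) - eps).
have A0 : 0 <= A by rewrite mulr_ge0 ?powR_ge0.
have hCA (f : euclidean R n -> R) : f \in Lfun (lebesgue n) s%:E ->
    ((\int[sphere_measure]_(e in unit_sphere)
       (kakeya_maximal P^-1%R f e) `^ r) `^ r^-1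
     <= A%:E * 'N[lebesgue n]_(s%:E)[EFin \o f])%E.
  move=> fL; apply: le_trans (hC f fL _ _) _; first by rewrite invr_gt0.
  rewrite lee_wpmul2r ?Lnorm_ge0// lee_fin ler_wpM2r ?powR_ge0//.
  exact: ler_norm.
have tsu' : 0 <= t < s * u by rewrite t0.
have c0 : 0 <= rho * (1 - q) / H `^ u * q ^+ k.
  by rewrite !mulr_ge0 ?invr_ge0 ?powR_ge0 ?exprn_ge0// ltW.
have hk0 : 0 <= h * (1 - q) * q ^+ k.
  by rewrite !mulr_ge0 ?exprn_ge0// ltW.
have := kakeya_scale_inequality n0 u0 hr s0 tsu' p1 D1 B0 K'D Fd (ltW Feta)
  (fun e (Ske : Sk k e) => Ske.1) c0 hk0 (ltW hk) A0 hCA (fun e Ske => Ske.2).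
rewrite leNgt => /negP; apply.
have Bk0 : 0 < B * 2^-1 ^+ k by rewrite mulr_gt0// exprn_gt0// invr_gt0.
rewrite -/P (mulrA 2) -/W /A -[X in X < _]mulrA scale_exponents//.
pose z : R := 2 `^ (- (sigma / 2)).
have z0 : 0 < z by rewrite powR_gt0.
have powRXn (y a : R) (j : nat) : 0 <= y -> (y ^+ j) `^ a = (y `^ a) ^+ j.
  by move=> y0; rewrite -!powR_mulrn ?powR_ge0// powRAC.
have qz : q ^+ k * (q ^+ k) `^ r^-1 = z ^+ k.
  rewrite powRXn ?(ltW q0)// -exprMn; congr (_ ^+ _).
  rewrite -{1}(powRr1 (ltW q0)) -powRD; last by rewrite (gt_eqF q0) implybT.
  by rewrite /q -powRrM divfK// gt_eqF.
have -> : kap * (rho * (1 - q) / H `^ u * q ^+ k) * (h * (1 - q) * q ^+ k) `^ r^-1 =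
    lower * z ^+ k.
  rewrite -qz powRM ?mulr_ge0 ?exprn_ge0 ?(ltW q0) ?(ltW h0) ?(ltW q1')//.
  by rewrite /lower; ring.
(* Each step of the scale contributes [p^eps 2^-sigma <= 2^(-sigma / 2)], so both sides carry the
   factor [z^k] and only [upper_lt] is left to decide. *)
have Pz : P `^ eps * (2^-1 ^+ k) `^ sigma <= z ^+ k.
  rewrite /P natrX !powRXn ?invr_ge0// -exprMn.
  apply: lerXn2r; rewrite ?nnegrE ?mulr_ge0 ?powR_ge0//.
  have pe : p%:R `^ eps <= 2 `^ (sigma / 2) :> R.
    rewrite /powR !gt_eqF ?ltr0n ?(ltn_trans _ p1)// ler_expR.
    by rewrite -ler_pdivlMr// ltW.
  apply: (@le_trans _ _ (2 `^ (sigma / 2) * 2 `^ (- sigma))).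
    have -> : 2^-1 `^ sigma = 2 `^ (- sigma) :> R.
      by rewrite -powR_inv1// -powRrM mulN1r.
    by apply: ler_wpM2r => //; exact: powR_ge0.
  rewrite -powRD; last by rewrite pnatr_eq0 implybT.
  by rewrite /z (_ : _ + _ = - (sigma / 2))//; lra.
rewrite -/sigma (powRM _ (ltW B0)) ?exprn_ge0 ?invr_ge0//.
rewrite (powRM _ (ltW eta10)) ?exprn_ge0 ?(ltW W0)//.
apply: (@le_lt_trans _ _ (upper * eta1 `^ s^-1 * z ^+ k)); last first.
  by rewrite ltr_pM2r// exprn_gt0.
have regroup (a b c e f v : R) :
    a * (b * (c * e) * (f * v)) = a * c * v * f * (b * e) by ring.
rewrite regroup.
apply: ler_pM => //; rewrite ?mulr_ge0 ?powR_ge0//.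
rewrite /upper !ler_wpM2r ?powR_ge0// lerDl.
exact: ler01.
Qed.
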